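(* Let $V=\coprod_{n=0}^{\infty}V_n$ be a unitary simple holomorphic vertex operator algebra over $\mathbb{C}$ of CFT-type. Then $V$ is rational, that is, every $\mathbb{N}$-gradable $V$-module is a direct sum of copies of $V$.
   Context: $(V,Y,\mathbf 1,\omega)$ is a vertex operator algebra (VOA) over $\mathbb{C}$ with vacuum $\mathbf 1$ and conformal vector $\omega$; write $Y(v,z)=\sum_{n\in\mathbb Z}v_nz^{-n-1}$ and $Y(\omega,z)=\sum_{n\in\mathbb Z}L(n)z^{-n-2}$. $V_n$ is the $L(0)$-eigenspace with eigenvalue $n$, and $\mathrm{wt}(v)=n$ for $v\in V_n$. CFT-type means $V=\bigoplus_{n\ge 0}V_n$ with $V_0=\mathbb{C}\mathbf 1$. $V$-modules are weak modules (each $v\in V$ acts by operators $v_n$ with $v_nm=0$ for $n$ large, for every $m$, satisfying the Jacobi identity and the vacuum axiom); $L(0)$ is not assumed to act semisimply. A $V$-module $M$ is $\mathbb{N}$-gradable if it has a decomposition $M=\bigoplus_{m=0}^{\infty}M_{(m)}$ such that $v_m(M_{(n)})\subseteq M_{(n+\mathrm{wt}(v)-m-1)}$ for all homogeneous $v\in V$ and all $m\in\mathbb Z$, $n\in\mathbb N$ (where $M_{(k)}=0$ for $k<0$). Holomorphic means that $V$ itself is, up to isomorphism, the only simple $\mathbb{N}$-gradable $V$-module. Unitary means: there are an anti-linear involution $\phi:V\to V$ (i.e. $\phi$ is anti-linear of order $2$, $\phi(\mathbf 1)=\mathbf 1$, $\phi(\omega)=\omega$, $\phi(u_nv)=\phi(u)_n\phi(v)$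 for all $u,v\in V$, $n\in\mathbb Z$) and a positive-definite Hermitian form $(\cdot,\cdot)_V:V\times V\to\mathbb{C}$, $\mathbb{C}$-linear in the first and anti-linear in the second variable, such that for all $a,u,v\in V$ $$(Y(e^{zL(1)}(-z^{-2})^{L(0)}a,z^{-1})u,v)_V=(u,Y(\phi(a),z)v)_V.$$ *)

(* Defs.v *)
From HB Require Import structures.
From mathcomp Require Import all_boot all_order all_algebra.
From mathcomp Require Export complex.
From mathcomp Require Import all_classical.
From mathcomp Require Export reals.

Set Implicit Arguments.
Unset Strict Implicit.
Unset Printing Implicit Defensive.

Import Order.TTheory GRing.Theory Num.Theory.

Local Open Scope classical_set_scope.
Local Open Scope ring_scope.

(* The complex numbers are [R[i]] with [R : realType].  All infinite sums below
   are finitely supported sums [\sum_(i \in [set: I]) F i] of MathComp-Analysis;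
   wherever one occurs, the surrounding axioms or hypotheses ensure that its
   support is finite. *)

Definition is_subspace (K : fieldType) (M : lmodType K) (A : set M) : Prop :=
  A 0 /\ (forall (a : K) (x y : M), A x -> A y -> A (a *: x + y)).

Definition decomposes (K : fieldType) (M : lmodType K) (I : choiceType)
    (A : I -> set M) (x : M) (f : I -> M) : Prop :=
  [/\ forall i, A i (f i),
      finite_set [set i | f i != 0]
    & x = \sum_(i \in [set: I]) f i].

Definition is_direct_sum (K : fieldType) (M : lmodType K) (I : choiceType)
    (A : I -> set M) : Prop :=
  (forall i, is_subspace (A i)) /\ (forall x, exists! f, decomposes A x f).

Definition finite_dimensional (K : fieldType) (M : lmodType K) (A : set M) :
    Prop :=
  exists (d : nat) (e : 'I_d -> M),
    forall x, A x -> exists c : 'I_d -> K, x = \sum_(i < d) c i *: e i.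

(* m (m - 1) ... (m - i + 1) / i! for m an arbitrary integer *)
Definition gbinom (K : fieldType) (m : int) (i : nat) : K :=
  (\prod_(j < i) (m - j%:Z)%:~R) / i`!%:R.

(* [act v n x] is v_n x.  The last clause is the coefficient of
   z0^(-l-1) z1^(-m-1) z2^(-n-1) in the Jacobi identity
     z0^-1 delta((z1 - z2)/z0) Y(u,z1) Y(v,z2) x
     - z0^-1 delta((z2 - z1)/(-z0)) Y(v,z2) Y(u,z1) x
     = z2^-1 delta((z1 - z0)/z2) Y(Y(u,z0) v,z2) x. *)
Definition weak_module_axioms (K : fieldType) (V : lmodType K)
    (Y : V -> int -> V -> V) (one : V)
    (M : lmodType K) (act : V -> int -> M -> M) : Prop :=
  [/\ (forall n x, linear (fun v => act v n x))
      /\ (forall v n, linear (act v n)),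
      forall v x, exists N : int, forall n : int, N <= n -> act v n x = 0,
      forall (n : int) x, act one n x = if n == - 1 then x else 0
    & forall (u v : V) (x : M) (l m n : int),
        \sum_(i \in [set: nat])
            gbinom K m i *: act (Y u (l + i%:Z) v) (m + n - i%:Z) x
        = \sum_(i \in [set: nat])
            ((- 1) ^+ i * gbinom K l i) *:
              (act u (m + l - i%:Z) (act v (n + i%:Z) x)
               - (- 1) ^ l *: act v (n + l - i%:Z) (act u (m + i%:Z) x))].

(* A Z-graded vertex operator algebra over R[i]; its homogeneous subspaces are
   the eigenspaces of L(0) = omega_1, and L(n) = omega_(n+1). *)
Record voa (R : realType) := VOA {
  voa_carrier :> lmodType R[i];
  mode : voa_carrier -> int -> voa_carrier -> voa_carrier;
  vacuum : voa_carrier;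
  conformal : voa_carrier;
  central_charge : R[i];
  voa_jacobi : weak_module_axioms mode vacuum mode;
  voa_creation : forall v, mode v (- 1) vacuum = v
    /\ (forall n : nat, mode v n%:Z vacuum = 0);
  voa_virasoro : forall (m n : int) (v : voa_carrier),
    let L (k : int) := mode conformal (k + 1) in
    L m (L n v) - L n (L m v)
    = (m - n)%:~R *: L (m + n) v
      + (if m + n == 0 then ((m ^+ 3 - m)%:~R / 12%:R * central_charge) *: v
         else 0);
  voa_derivative : forall (v w : voa_carrier) (n : int),
    mode (mode conformal 0 v) n w = - (n%:~R *: mode v (n - 1) w);
  voa_graded :
    is_direct_sum (fun (n : int) v => mode conformal 1 v = n%:~R *: v);
  voa_finite_dim : forall n : int,
    finite_dimensional [set v | mode conformal 1 v = n%:~R *: v];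
  voa_lower_bounded : exists N : int, forall (n : int) (v : voa_carrier),
    n < N -> mode conformal 1 v = n%:~R *: v -> v = 0
}.

Definition Lop (R : realType) (V : voa R) (n : int) (v : V) : V :=
  mode (conformal V) (n + 1) v.

Definition weight_space (R : realType) (V : voa R) (n : int) : set V :=
  [set v | Lop 0 v = n%:~R *: v].

Definition cft_type (R : realType) (V : voa R) : Prop :=
  is_direct_sum (fun n : nat => @weight_space R V n%:Z)
  /\ @weight_space R V 0 = [set v | exists c : R[i], v = c *: vacuum V].

Record vmodule (R : realType) (V : voa R) := VModule {
  vmodule_carrier :> lmodType R[i];
  act : V -> int -> vmodule_carrier -> vmodule_carrier;
  vmodule_axioms : weak_module_axioms (@mode R V) (vacuum V) act
}.

Definition adjoint_module (R : realType) (V : voa R) : vmodule V :=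
  VModule (voa_jacobi V).

Definition is_submodule (R : realType) (V : voa R) (M : vmodule V)
    (A : set M) : Prop :=
  is_subspace A /\ (forall (v : V) (n : int) x, A x -> A (act v n x)).

Definition simple_module (R : realType) (V : voa R) (M : vmodule V) : Prop :=
  (exists x : M, x != 0)
  /\ (forall A : set M, is_submodule A -> A = [set 0] \/ A = [set: M]).

Definition simple_voa (R : realType) (V : voa R) : Prop :=
  simple_module (adjoint_module V).

Definition module_hom (R : realType) (V : voa R) (M N : vmodule V)
    (f : M -> N) : Prop :=
  linear f /\ (forall (v : V) (n : int) x, f (act v n x) = act v n (f x)).

Definition module_iso (R : realType) (V : voa R) (M N : vmodule V) : Prop :=
  exists f : M -> N, module_hom f /\ bijective f.

Definition extend_by_zero (K : fieldType) (M : lmodType K) (A : nat -> set M)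
    (k : int) : set M :=
  match k with Posz n => A n | Negz _ => [set 0] end.

Definition N_gradable (R : realType) (V : voa R) (M : vmodule V) : Prop :=
  exists A : nat -> set M,
    is_direct_sum A
    /\ (forall (k m : int) (n : nat) (v : V) (x : M),
          weight_space k v -> A n x ->
          extend_by_zero A (n%:Z + k - m - 1) (act v m x)).

Definition holomorphic (R : realType) (V : voa R) : Prop :=
  [/\ simple_module (adjoint_module V),
      N_gradable (adjoint_module V)
    & forall M : vmodule V, simple_module M -> N_gradable M ->
        module_iso (adjoint_module V) M].

Definition antilinear_involution (R : realType) (V : voa R) (phi : V -> V) :
    Prop :=
  [/\ forall (c : R[i]) (u v : V), phi (c *: u + v) = c^* *: phi u + phi v,
      forall v, phi (phi v) = v,
      phi (vacuum V) = vacuum V,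
      phi (conformal V) = conformal V
    & forall (u v : V) (n : int), phi (mode u n v) = mode (phi u) n (phi v)].

(* Strict positivity in the partial order of R[i] entails being real. *)
Definition positive_hermitian (R : realType) (V : voa R)
    (form : V -> V -> R[i]) : Prop :=
  [/\ forall (c : R[i]) (u v w : V),
        form (c *: u + v) w = c * form u w + form v w,
      forall u v : V, form u v = (form v u)^*
    & forall v : V, v != 0 -> 0 < form v v].

(* The coefficient of z^(-m-1) in
     (Y(e^(z L(1)) (-z^-2)^L(0) a, z^-1) u, v) = (u, Y(phi(a), z) v).
   If a = \sum_k a_k with a_k of weight k, then
     e^(z L(1)) (-z^-2)^L(0) a
       = \sum_k \sum_j (-1)^k / j! z^(j - 2 k) L(1)^j a_k,
   and Y(b, z^-1) = \sum_n b_n z^(n + 1). *)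
Definition invariant_form (R : realType) (V : voa R) (phi : V -> V)
    (form : V -> V -> R[i]) : Prop :=
  forall (a : V) (a_ : int -> V) (u v : V) (m : int),
    decomposes (@weight_space R V) a a_ ->
    \sum_(k \in [set: int]) \sum_(j \in [set: nat])
       ((- 1) ^ k / j`!%:R
        * form (mode (iter j (@Lop R V 1) (a_ k)) (2 * k - j%:Z - m - 2) u) v)
    = form u (mode (phi a) m v).

Definition unitary (R : realType) (V : voa R) : Prop :=
  exists (phi : V -> V) (form : V -> V -> R[i]),
    [/\ antilinear_involution phi,
        positive_hermitian form
      & invariant_form phi form].

Definition direct_sum_of_copies (R : realType) (V : voa R) (N M : vmodule V) :
    Prop :=
  exists (I : choiceType) (f : I -> N -> M),
    (forall i, module_hom (f i) /\ injective (f i))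
    /\ is_direct_sum (fun i => range (f i)).

(* Main.v *)
(* A homomorphism from V to a module M is determined by a vacuum-like vector,
   that is a vector killed by L(-1), so it suffices to show that an N-gradable
   M is generated by its vacuum-like vectors.

   Zorn's lemma and holomorphy give, for finitely many homogeneous vectors of
   M not all zero, a graded quotient Q of M and an embedding of V in Q whose
   image contains the images of these vectors, not all zero.  Let x have degree
   0 in M.  If u_0 x = 0 for all u in V_1, then L(-1) x = 0: otherwise the image
   of L(-1) x in such a Q is a w in V_1 killed by all u_1, which is impossible
   by unitarity, or a multiple of the vacuum, which L(0) excludes.

   Next, u_0 x = 0 for every u in V_1.  Otherwise some Q contains V with
   L(-1) x = h, a nonzero vector of V_1.  As exp(- z L(-1)) Y(v, z) x is a
   Laurent series, its derivative has no residue, and this says h_0 v = 0 for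
   all v in V.  Put a = phi(h); by unitarity a_1 h is a nonzero multiple of the
   vacuum, while a_0 = 0.  Twisting V by Li's operator
   Delta(a, z) = exp(sum_{n > 0} (-1)^(n+1) a_n z^(-n) / n) gives an N-gradable
   module on which h_0 is a nonzero scalar, although h_0 = 0 on V, its only
   possible simple subquotient.

   So the lowest degree of M consists of vacuum-like vectors.  An induction on
   the degree d, applying this to the quotient of M by the submodule generated
   by vacuum-like vectors of degree < d, finishes the proof: the eigenvalues of
   L(0) allow one to correct a vector of degree d to a vacuum-like one. *)
From HB Require Import structures.
From mathcomp Require Import all_boot all_order all_algebra.
From mathcomp Require Import all_classical.
From mathcomp Require Import ring zify.
Require Import Defs.

Set Implicit Arguments.
Unset Strict Implicit.
Unset Printing Implicit Defensive.

Import Order.TTheory GRing.Theory Num.Theory.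

Local Open Scope classical_set_scope.
Local Open Scope ring_scope.

(** * Finite sums and binomial coefficients *)

Section Sums.
Variable M : zmodType.

Lemma fsum_nat (F : nat -> M) (B : nat) :
  (forall i, (B <= i)%N -> F i = 0) ->
  \sum_(i \in [set: nat]) F i = \sum_(i < B) F i.
Proof.
move=> F0; rewrite (fsbig_ord _ _ F); apply/esym/fsbig_widen => // i [_ /= /negP].
by rewrite -leqNgt => /F0.
Qed.

Lemma sum_widen (F : nat -> M) (B B' : nat) : (B <= B')%N ->
  (forall i, (B <= i)%N -> F i = 0) ->
  \sum_(i < B') F i = \sum_(i < B) F i.
Proof. by move=> BB' F0; rewrite -!fsum_nat // => i /(leq_trans BB')/F0. Qed.

Lemma fsum_supp1 (I : choiceType) (i0 : I) (F : I -> M) :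
  (forall i, i != i0 -> F i = 0) -> \sum_(i \in [set: I]) F i = F i0.
Proof.
move=> F0; rewrite -(@fsbig_widen _ _ _ _ [set i0]) ?fsbig_set1 //.
by move=> i [_ /= /eqP/F0].
Qed.

Lemma big_triangle (F : nat -> nat -> M) (n : nat) :
  \sum_(j < n.+1) \sum_(p < (n - j).+1) F j p
  = \sum_(j < n.+1) \sum_(p < n.+1 | (j + p <= n)%N) F j p.
Proof.
apply: eq_bigr => -[j /= jn] _; rewrite (big_ord_widen n.+1 (F j)); last by lia.
by apply: eq_bigl => p; lia.
Qed.

Lemma exchange_triangle (F : nat -> nat -> M) (n : nat) :
  \sum_(j < n.+1) \sum_(p < (n - j).+1) F j p
  = \sum_(p < n.+1) \sum_(j < (n - p).+1) F j p.
Proof.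
rewrite big_triangle (exchange_big_dep xpredT) //= (big_triangle (fun p j => F j p)).
by apply: eq_bigr => j _; apply: eq_bigl => p; rewrite addnC.
Qed.

Lemma triangle_diag (F : nat -> nat -> M) (n : nat) :
  \sum_(q < n.+1) \sum_(j < q.+1) F j (q - j)%N
  = \sum_(j < n.+1) \sum_(p < (n - j).+1) F j p.
Proof.
elim: n => [|n IH]; first by rewrite !big_ord1.
rewrite big_ord_recr /= IH [RHS]big_ord_recr /= subnn big_ord1.
rewrite [X in _ + X]big_ord_recr /= subnn addrA; congr (_ + _).
rewrite -big_split /=; apply: eq_bigr => -[j jn] _ /=.
by rewrite subSn // [RHS]big_ord_recr.
Qed.

End Sums.

(** * Binomial coefficients with integer upper argument *)

Section Binomials.
Variable K : numFieldType.
Implicit Types m n : int.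
Local Notation g := (gbinom K).

Lemma gbinom0 m : g m 0 = 1.
Proof. by rewrite /gbinom big_ord0 fact0 divr1. Qed.

Lemma gbinomS m i : i.+1%:R * g m i.+1 = (m - i%:Z)%:~R * g m i.
Proof.
rewrite /gbinom big_ord_recr /= factS natrM.
have i1 : (i.+1)%:R != 0 :> K by rewrite pnatr_eq0.
have i2 : (i`!)%:R != 0 :> K by rewrite pnatr_eq0 -lt0n fact_gt0.
by move: (i.+1%:R) (i`!%:R) i1 i2 => x y x0 y0; field; rewrite x0 y0.
Qed.

Lemma gbinom_rec m i : g m i.+1 = (m - i%:Z)%:~R * g m i / i.+1%:R.
Proof. by rewrite -gbinomS mulrC mulKf // pnatr_eq0. Qed.

Lemma gbinom1 m : g m 1 = m%:~R.
Proof. by rewrite gbinom_rec gbinom0 subr0 mulr1 divr1. Qed.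

Lemma gbinom0S i : g 0 i.+1 = 0.
Proof. by elim: i => [|i IH]; rewrite gbinom_rec ?IH ?mulr0 ?mul0r // subr0 !mul0r. Qed.

Lemma gbinom1SS i : g 1 i.+2 = 0.
Proof.
by elim: i => [|i IH]; rewrite gbinom_rec ?IH ?mulr0 ?mul0r // subrr !mul0r.
Qed.

Lemma gbinom_pascal m i : g (m + 1) i.+1 = g m i.+1 + g m i.
Proof.
elim: i => [|i IH]; first by rewrite !gbinom1 gbinom0 rmorphD.
have n0 : i.+2%:R != 0 :> K by rewrite pnatr_eq0.
apply: (mulfI n0); rewrite mulrDr !gbinomS IH mulrDr.
rewrite (_ : m + 1 - i.+1%:Z = m - i%:Z); last by lia.
rewrite -[X in _ + X = _]gbinomS -!mulrDl; congr (_ * _).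
by rewrite -[i.+1%:R]/(i.+1%:Z%:~R) -[i.+2%:R]/(i.+2%:Z%:~R) -!rmorphD /=;
  congr (_%:~R); lia.
Qed.

(** The defect of the identity obeys Pascal's rule in [m] and [i] and vanishes for [m = 0] and for
    [i = 0]. Induction upwards and downwards from [m = 0] then makes it vanish everywhere. *)
Lemma gbinom_vandermonde m n i :
  g (m + n) i = \sum_(j < i.+1) g m j * g n (i - j).
Proof.
pose d k i := g (k + n) i - \sum_(j < i.+1) g k j * g n (i - j).
suff d0 k j : d k j = 0 by apply/eqP; rewrite -subr_eq0; apply/eqP/d0.
have dk0 k0 : d k0 0%N = 0 by rewrite /d big_ord1 !gbinom0 mulr1 subrr.
have d0i i0 : d 0 i0 = 0.
  rewrite /d add0r big_ord_recl gbinom0 mul1r subn0 big1 ?addr0 ?subrr // => l _.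
  by rewrite gbinom0S mul0r.
have dS k0 i0 : d (k0 + 1) i0.+1 = d k0 i0.+1 + d k0 i0.
  rewrite /d (_ : k0 + 1 + n = k0 + n + 1) ?gbinom_pascal; last by lia.
  rewrite [X in _ - X = _]big_ord_recl [X in _ = _ - X + _]big_ord_recl.
  rewrite !gbinom0 (eq_bigr (fun l : 'I_i0.+1 =>
    g k0 l.+1 * g n (i0.+1 - l.+1) + g k0 l * g n (i0 - l))) => [|l _].
    by rewrite big_split /=; ring.
  by rewrite gbinom_pascal mulrDl.
elim/int_ind: k j => [|k IH|k IH] j //.
  by case: j => // j; rewrite -addn1 PoszD dS !IH addr0.
elim: j => // j IHj; have := dS (- k.+1%:Z) j.
rewrite (_ : - k.+1%:Z + 1 = - k%:Z) ?IH ?IHj ?addr0 //; lia.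
Qed.

Lemma gbinom_shift m l : (m - l%:Z + 1)%:~R * g (m + 1) l = (m + 1)%:~R * g m l.
Proof.
elim: l => [|l IH]; first by rewrite subr0 !gbinom0.
have n0 : l.+1%:R != 0 :> K by rewrite pnatr_eq0.
apply: (mulfI n0); rewrite mulrCA gbinomS [RHS]mulrCA gbinomS.
rewrite [RHS]mulrCA -IH (_ : m + 1 - l%:Z = m - l%:Z + 1); last by lia.
by congr (_%:~R * _); lia.
Qed.

(** Upper negation, as in the expansion of (1 + t)^(-l-1). It turns the signed binomials of the
    commutator formula into ones to which Vandermonde's identity applies. *)
Lemma gbinom_reflect (l s : nat) :
  (- 1) ^+ s * g (l + s)%N%:Z l = g (- l.+1%:Z) s.
Proof.
elim: s => [|s IHs].
  rewrite mul1r addn0 gbinom0; elim: l => [|l IH]; first by rewrite gbinom0.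
  rewrite -addn1 PoszD addn1 gbinom_pascal IH gbinom_rec.
  by rewrite subrr mul0r mul0r add0r.
have n0 : s.+1%:R != 0 :> K by rewrite pnatr_eq0.
apply: (mulfI n0); rewrite gbinomS -IHs exprS addnS.
rewrite (_ : Posz (l + s).+1 = (l + s)%N%:Z + 1); last by lia.
have := gbinom_shift (l + s)%N%:Z l.
rewrite (_ : (l + s)%N%:Z - l%:Z + 1 = s.+1%:Z); last by lia.
rewrite -[s.+1%:Z%:~R]/(s.+1%:R) => e.
have -> : (- l.+1%:Z - s%:Z)%:~R = - ((l + s)%N%:Z + 1)%:~R :> K.
  by rewrite -rmorphN; congr (_%:~R); lia.
by rewrite mulrCA e mulN1r !mulNr mulrCA.
Qed.

(** Absorption for a negative upper argument; in [Delta_mode_rec] it trades the factor [N.+1] for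
    one that [Delta_coefS] can expand. *)
Lemma gbinom_negS (p i : nat) :
  (p + i)%:R * g (- p%:Z) i = p%:R * g (- p.+1%:Z) i.
Proof.
elim: i => [|i IH]; first by rewrite addn0 !gbinom0.
have n0 : i.+1%:R != 0 :> K by rewrite pnatr_eq0.
apply: (mulfI n0); rewrite mulrCA gbinomS [RHS]mulrCA gbinomS.
rewrite [RHS]mulrCA -IH [LHS]mulrA [RHS]mulrA; congr (_ * _).
rewrite -[(p + i.+1)%:R]/((p + i.+1)%N%:Z%:~R) -[(p + i)%:R]/((p + i)%N%:Z%:~R)
  -!rmorphM /=; congr (_%:~R); lia.
Qed.

End Binomials.

(** * Weak modules *)

Section LinearMaps.
Variables (K : numFieldType) (U W : lmodType K) (f : U -> W).
Hypothesis fl : linear f.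

Lemma linD x y : f (x + y) = f x + f y.
Proof. by rewrite -[x]scale1r fl !scale1r. Qed.

Lemma lin0 : f 0 = 0.
Proof. by apply: (addrI (f 0)); rewrite -linD !addr0. Qed.

Lemma linZ a x : f (a *: x) = a *: f x.
Proof. by rewrite -[a *: x]addr0 fl lin0 addr0. Qed.

Lemma linN x : f (- x) = - f x.
Proof. by rewrite -scaleN1r linZ scaleN1r. Qed.

Lemma linB x y : f (x - y) = f x - f y.
Proof. by rewrite linD linN. Qed.

Lemma lin_sum (I : Type) (r : seq I) (P : pred I) (F : I -> U) :
  f (\sum_(i <- r | P i) F i) = \sum_(i <- r | P i) f (F i).
Proof. by apply: (big_morph f linD lin0). Qed.

End LinearMaps.

Section Subspaces.
Variables (K : numFieldType) (U : lmodType K) (A : set U).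
Hypothesis As : is_subspace A.

Lemma subspace0 : A 0. Proof. by case: As. Qed.

Lemma subspaceD x y : A x -> A y -> A (x + y).
Proof. by move=> Ax Ay; rewrite -[x]scale1r; apply: (proj2 As). Qed.

Lemma subspaceZ a x : A x -> A (a *: x).
Proof. by move=> Ax; rewrite -[_ *: _]addr0; apply: (proj2 As) => //;
  exact: subspace0. Qed.

Lemma subspaceN x : A x -> A (- x).
Proof. by rewrite -scaleN1r; apply: subspaceZ. Qed.

Lemma subspaceB x y : A x -> A y -> A (x - y).
Proof. by move=> Ax /subspaceN; apply: subspaceD. Qed.

Lemma subspace_sum_ord (n : nat) (F : 'I_n -> U) :
  (forall i, A (F i)) -> A (\sum_(i < n) F i).
Proof. by move=> AF; apply: (big_ind A); [exact: subspace0|exact: subspaceD|]. Qed.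

Lemma subspaceZ_inv a x : a != 0 -> A (a *: x) -> A x.
Proof. by move=> a0 /(subspaceZ a^-1); rewrite scalerA mulVf // scale1r. Qed.

End Subspaces.

Section WeakModules.
Variables (K : numFieldType) (V : lmodType K) (Y : V -> int -> V -> V) (one : V).
Hypothesis HY : weak_module_axioms Y one Y.
Variables (M : lmodType K) (act : V -> int -> M -> M).
Hypothesis H : weak_module_axioms Y one act.
Implicit Types (u v : V) (x y : M) (l m n : int).

Lemma act_linl n x : linear (fun v => act v n x).
Proof. by case: H => -[]. Qed.

Lemma act_linr v n : linear (act v n).
Proof. by case: H => -[]. Qed.

Lemma actD v n x y : act v n (x + y) = act v n x + act v n y.
Proof. exact: linD (act_linr v n) x y. Qed.

Lemma actB v n x y : act v n (x - y) = act v n x - act v n y.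
Proof. exact: linB (act_linr v n) x y. Qed.

Lemma actN v n x : act v n (- x) = - act v n x.
Proof. exact: linN (act_linr v n) x. Qed.

Lemma actZ v n a x : act v n (a *: x) = a *: act v n x.
Proof. exact: linZ (act_linr v n) a x. Qed.

Lemma act0 v n : act v n 0 = 0.
Proof. exact: lin0 (act_linr v n). Qed.

Lemma act_sum v n (I : Type) (r : seq I) (P : pred I) (F : I -> M) :
  act v n (\sum_(i <- r | P i) F i) = \sum_(i <- r | P i) act v n (F i).
Proof. exact: lin_sum (act_linr v n) _ r P F. Qed.

Lemma actlB u v n x : act (u - v) n x = act u n x - act v n x.
Proof. exact: linB (act_linl n x) u v. Qed.

Lemma actlZ a v n x : act (a *: v) n x = a *: act v n x.
Proof. exact: linZ (act_linl n x) a v. Qed.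

Lemma actl0 n x : act 0 n x = 0.
Proof. exact: lin0 (act_linl n x). Qed.

Lemma actl_sum n x (I : Type) (r : seq I) (P : pred I) (F : I -> V) :
  act (\sum_(i <- r | P i) F i) n x = \sum_(i <- r | P i) act (F i) n x.
Proof. exact: lin_sum (act_linl n x) _ r P F. Qed.

Lemma act_one n x : act one n x = if n == - 1 then x else 0.
Proof. by case: H. Qed.

Lemma act_trunc v x : exists N : nat, forall n, N%:Z <= n -> act v n x = 0.
Proof.
have [_ /(_ v x)[N NP] _ _] := H.
by exists `|N|%N => n Nn; apply: NP; lia.
Qed.

End WeakModules.

(** * Consequences of the Jacobi identity *)

Section Jacobi.
Variables (K : numFieldType) (V : lmodType K) (Y : V -> int -> V -> V) (one : V).
Hypothesis HY : weak_module_axioms Y one Y.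
Variables (M : lmodType K) (act : V -> int -> M -> M).
Hypothesis H : weak_module_axioms Y one act.
Implicit Types (u v : V) (x y : M) (l m n : int).
Local Notation g := (gbinom K).

Definition jacobi_term u v x l m n (i : nat) : M :=
  ((- 1) ^+ i * g l i) *:
    (act u (m + l - i%:Z) (act v (n + i%:Z) x)
     - (- 1) ^ l *: act v (n + l - i%:Z) (act u (m + i%:Z) x)).

(** Both sides have finite support, so they may be cut at any large common length. Allowing every
    larger length lets several such identities be compared at one bound. *)
Lemma jacobi_sum u v x l m n : exists B0 : nat, forall B, (B0 <= B)%N ->
  \sum_(i < B) g m i *: act (Y u (l + i%:Z) v) (m + n - i%:Z) x
  = \sum_(i < B) jacobi_term u v x l m n i.
Proof.
have [N1 N1P] := act_trunc HY u v.
have [N2 N2P] := act_trunc H v x.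
have [N3 N3P] := act_trunc H u x.
exists (N1 + N2 + N3 + `|l| + `|m| + `|n|)%N => B hB.
have [_ _ _ /(_ u v x l m n)] := H.
rewrite (@fsum_nat _ _ B) => [|i iB]; last first.
  by rewrite N1P ?(actl0 H) ?scaler0 //; lia.
rewrite (@fsum_nat _ _ B) => [//|i iB].
by rewrite N2P ?N3P ?(act0 H) ?scaler0 ?subr0 ?scaler0 //; lia.
Qed.

(** The case [l = 0] of the Jacobi identity: [g 0 i] vanishes for positive [i], which leaves the
    commutator alone on the right. *)
Lemma commutator u v x m n (B : nat) :
  (forall i : nat, (B <= i)%N -> Y u i%:Z v = 0) ->
  act u m (act v n x) - act v n (act u m x)
  = \sum_(i < B) g m i *: act (Y u i%:Z v) (m + n - i%:Z) x.
Proof.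
move=> hB; have [B0 /(_ (B0 + B).+1)] := jacobi_sum u v x 0 m n.
have /[swap] /[apply] : (B0 <= (B0 + B).+1)%N by lia.
rewrite (@sum_widen _ (fun i => g m i *: act (Y u (0 + i%:Z) v) (m + n - i%:Z) x) B).
- rewrite big_ord_recl [X in _ = _ + X -> _]big1 ?addr0 => [|i _]; last first.
    by rewrite /jacobi_term lift0 gbinom0S mulr0 scale0r.
  rewrite /jacobi_term /= gbinom0 mulr1 expr0z !scale1r !addr0 ?subr0 => <-.
  by apply: eq_bigr => i _; rewrite add0r.
- lia.
- by move=> i /hB; rewrite add0r => ->; rewrite (actl0 H) scaler0.
Qed.

Lemma commutator0 u v x n :
  act u 0 (act v n x) = act v n (act u 0 x) + act (Y u 0 v) n x.
Proof.
have [N NP] := act_trunc HY u v.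
apply/eqP; rewrite addrC -subr_eq; apply/eqP.
rewrite (@commutator u v x 0 n N.+1) => [|i iN]; last by apply: NP; lia.
rewrite big_ord_recl gbinom0 scale1r add0r subr0 big1 ?addr0 // => i _.
by rewrite lift0 gbinom0S scale0r.
Qed.

Lemma commutator1 u v x n :
  act u 1 (act v n x)
  = act v n (act u 1 x) + act (Y u 0 v) (n + 1) x + act (Y u 1 v) n x.
Proof.
have [N NP] := act_trunc HY u v.
apply/eqP; rewrite -addrA addrC -subr_eq; apply/eqP.
rewrite (@commutator u v x 1 n N.+2) => [|i iN]; last by apply: NP; lia.
have g1 : g 1 1 = 1 by rewrite gbinom1.
rewrite !big_ord_recl big1 => [|i _]; last first.
  by rewrite !lift0 gbinom1SS scale0r.
by rewrite lift0 gbinom0 g1 !scale1r subr0 addr0 (addrC 1 n) addrK.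
Qed.

(** The case [m = 0] of the Jacobi identity: here the left side collapses to its first term. *)
Lemma iterate u v x l n : exists B0 : nat, forall B, (B0 <= B)%N ->
  act (Y u l v) n x = \sum_(i < B) jacobi_term u v x l 0 n i.
Proof.
have [B0 B0P] := jacobi_sum u v x l 0 n.
exists B0.+1 => B hB; rewrite -B0P ?(ltnW hB) //.
case: B hB => // B _; rewrite big_ord_recl gbinom0 scale1r !addr0 add0r ?subr0.
by rewrite big1 ?addr0 // => i _; rewrite gbinom0S scale0r.
Qed.

End Jacobi.

(** * Deformation by a weight one vector *)

Lemma gbinom_small (K : numFieldType) (n i : nat) : (n < i)%N -> gbinom K n i = 0.
Proof.
elim: i => // i IH ni; rewrite gbinom_rec.
move: ni; rewrite ltnS leq_eqVlt => /predU1P[->|/IH->]; last by rewrite mulr0 mul0r.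
by rewrite subrr !mul0r.
Qed.

Section DeformationCoefficients.
Variables (K : numFieldType) (V : lmodType K) (Y : V -> int -> V -> V) (a : V).

(* [Delta_coef n] is the coefficient of z^(-n) in Delta(a, z), computed by
   applying z d/dz; [Delta_aux n k] agrees with it for [k <= n]. *)
Fixpoint Delta_aux (n : nat) : nat -> V -> V :=
  match n with
  | 0 => fun _ v => v
  | n'.+1 => fun k v =>
      if (k <= n')%N then Delta_aux n' k v
      else n'.+1%:R^-1 *:
        \sum_(j < n'.+1) (- 1) ^+ j *: Y a j.+1%:Z (Delta_aux n' (n' - j) v)
  end.

Definition Delta_coef n v := Delta_aux n n v.
Local Notation E := Delta_coef.

Lemma Delta_auxE n k v : (k <= n)%N -> Delta_aux n k v = E k v.
Proof.
elim: n => [|n IH] kn; first by move: kn; rewrite leqn0 => /eqP->.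
have [kn'|kn'] := leqP k n; first by rewrite /= kn' IH.
by rewrite (_ : k = n.+1) //; lia.
Qed.

Lemma Delta_coefS n v :
  n.+1%:R *: E n.+1 v = \sum_(j < n.+1) (- 1) ^+ j *: Y a j.+1%:Z (E (n - j) v).
Proof.
rewrite /Delta_coef /= ltnn scalerA mulfV ?pnatr_eq0 // scale1r.
by apply: eq_bigr => j _; rewrite Delta_auxE // leq_subr.
Qed.

End DeformationCoefficients.

(** * Conjugation of vertex operators by Delta(a, z) *)

Section Deformation.
Variables (K : numFieldType) (V : lmodType K) (Y : V -> int -> V -> V) (one : V).
Hypothesis HY : weak_module_axioms Y one Y.
Variable a : V.
Hypothesis a0 : forall v, Y a 0 v = 0.
Local Notation g := (gbinom K).
Local Notation E := (Delta_coef Y a).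
Implicit Types (u v w : V) (l m n : int).

Lemma Delta_coef_linear (n : nat) : linear (E n).
Proof.
elim/ltn_ind: n => -[|n] IH c u v //.
have n0 : n.+1%:R != 0 :> K by rewrite pnatr_eq0.
apply: (scalerI n0); rewrite scalerDr scalerA mulrC -scalerA !Delta_coefS.
rewrite scaler_sumr -big_split /=; apply: eq_bigr => j _.
rewrite IH; last by rewrite ltnS leq_subr.
by rewrite (act_linr HY) scalerDr !scalerA mulrC.
Qed.

Lemma commutator_nat u v (j : nat) n :
  Y a j.+1%:Z (Y u n v) - Y u n (Y a j.+1%:Z v)
  = \sum_(l < j.+1) g j.+1%:Z l.+1 *: Y (Y a l.+1%:Z u) (j%:Z + n - l%:Z) v.
Proof.
have [N NP] := act_trunc HY a u.
rewrite (@commutator _ _ _ _ HY _ _ HY _ _ _ _ _ (N + j).+2) => [|i iN]; last first.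
  by apply: NP; lia.
rewrite big_ord_recl a0 (actl0 HY) scaler0 add0r.
rewrite (@sum_widen _ (fun i =>
  g j.+1%:Z i.+1 *: Y (Y a i.+1%:Z u) (j.+1%:Z + n - i.+1%:Z) v) j.+1).
- by apply: eq_bigr => i _; congr (_ *: Y _ _ _); lia.
- lia.
- by move=> i ji; rewrite gbinom_small ?scale0r.
Qed.

(* The coefficient of z^(-N) z0^(-m-1) in Y(Delta(a, z + z0) u, z0). *)
Definition Delta_mode u (N : nat) m w : V :=
  \sum_(p < N.+1) g (- p%:Z) (N - p) *: Y (E p u) (m + (N - p)%N%:Z) w.

Lemma Delta_mode_linear u (N : nat) m : linear (Delta_mode u N m).
Proof.
move=> c x y; rewrite /Delta_mode scaler_sumr -big_split; apply: eq_bigr => p _ /=.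
by rewrite (act_linr HY) scalerDr !scalerA mulrC.
Qed.

(** The differential equation of Y(Delta(a, z + z0) u, z0) in z: -z d/dz acts on it as the
    commutator with the sum of the (-1)^j a_(j+1) z^(-j-1). Both sides are expanded in the vectors
    [T p l] and their coefficients compared. *)
Lemma Delta_mode_rec u (N : nat) m w :
  N.+1%:R *: Delta_mode u N.+1 m w
  = \sum_(j < N.+1) (- 1) ^+ j *:
      (Y a j.+1%:Z (Delta_mode u (N - j) m w) - Delta_mode u (N - j) m (Y a j.+1%:Z w)).
Proof.
pose T (p l : nat) := Y (Y a l.+1%:Z (E p u)) (m + N%:Z - p%:Z - l%:Z) w.
transitivity (\sum_(j < N.+1) \sum_(p < (N - j).+1)
    ((- 1) ^+ j * g (- (j + p).+2%:Z) (N - (j + p))) *: T p j).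
  rewrite -(triangle_diag (fun j p =>
    ((- 1) ^+ j * g (- (j + p).+2%:Z) (N - (j + p))) *: T p j)).
  rewrite /Delta_mode big_ord_recl /= subn0 oppr0 gbinom0S scale0r add0r scaler_sumr.
  apply: eq_bigr => -[q /= qN] _; rewrite /bump /= add1n subSS scalerA.
  have -> : N.+1%:R = (q.+1 + (N - q))%:R :> K by congr (_%:R); lia.
  rewrite gbinom_negS mulrC -scalerA -(actlZ HY) Delta_coefS (actl_sum HY) scaler_sumr.
  apply: eq_bigr => -[j /= jq] _; rewrite (actlZ HY) scalerA mulrC subnKC //.
  by congr (_ *: Y _ _ _); lia.
transitivity (\sum_(j < N.+1) \sum_(p < (N - j).+1) \sum_(l < j.+1)
    ((- 1) ^+ j * g (- p%:Z) (N - j - p) * g j.+1%:Z l.+1) *: T p l); last first.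
  apply: eq_bigr => -[j /= jN] _.
  rewrite /Delta_mode (act_sum HY) -sumrB scaler_sumr; apply: eq_bigr => -[p /= pN] _.
  rewrite (actZ HY) -scalerBr commutator_nat !scaler_sumr.
  by apply: eq_bigr => -[l /= lj] _; rewrite !scalerA mulrA; congr (_ *: Y _ _ _); lia.
rewrite (exchange_triangle (fun j p =>
    ((- 1) ^+ j * g (- (j + p).+2%:Z) (N - (j + p))) *: T p j)).
rewrite [RHS](exchange_triangle (fun j p => \sum_(l < j.+1)
    ((- 1) ^+ j * g (- p%:Z) (N - j - p) * g j.+1%:Z l.+1) *: T p l)).
apply: eq_bigr => -[p /= pN] _.
transitivity (\sum_(q < (N - p).+1) \sum_(l < q.+1) 
   ((- 1) ^+ (l + (q - l)) * g (- p%:Z) (N - (l + (q - l)) - p)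
     * g (l + (q - l)).+1%:Z l.+1) *: T p l); last first.
  by apply: eq_bigr => q _; apply: eq_bigr => -[l /= lq] _; rewrite subnKC.
rewrite (triangle_diag (fun l s : nat =>
  ((- 1) ^+ (l + s) * g (- p%:Z) (N - (l + s) - p)
     * g (l + s).+1%:Z l.+1) *: T p l)).
apply: eq_bigr => -[l /= lN] _; rewrite -scaler_suml; congr (_ *: _).
have -> : - (l + p).+2%:Z = - l.+2%:Z + - p%:Z by lia.
have -> : (N - (l + p) = N - p - l)%N by lia.
(* With s = j - l, the coefficient of [T p l] on the right is a Vandermonde sum once
   [gbinom_reflect] has absorbed the sign (-1)^s. *)
rewrite gbinom_vandermonde mulr_sumr; apply: eq_bigr => -[s /= sN] _.
rewrite -gbinom_reflect exprD addSn.
have -> : (N - (l + s) - p = N - p - l - s)%N by lia.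
by ring.
Qed.

(** The coefficient of z^(-N) in Li's conjugation formula Delta(a, z) Y(u, z0) = Y(Delta(a, z + z0)
    u, z0) Delta(a, z). Both sides obey the same recursion in [N]. *)
Lemma Delta_coef_mode (N : nat) u m v :
  E N (Y u m v) = \sum_(q < N.+1) Delta_mode u (N - q) m (E q v).
Proof.
elim/ltn_ind: N => -[|N] IH;
  first by rewrite big_ord1 /Delta_mode big_ord1 gbinom0 scale1r addr0.
have n0 : N.+1%:R != 0 :> K by rewrite pnatr_eq0.
apply: (scalerI n0); rewrite Delta_coefS.
pose G (j p : nat) := (- 1) ^+ j *: Delta_mode u (N - j - p) m (Y a j.+1%:Z (E p v)).
transitivity (\sum_(j < N.+1) \sum_(q < (N - j).+1)
    (- 1) ^+ j *: Y a j.+1%:Z (Delta_mode u (N - j - q) m (E q v))).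
  apply: eq_bigr => -[j /= jN] _; rewrite IH ?(act_sum HY) ?scaler_sumr //.
  by rewrite ltnS leq_subr.
(* Leibniz rule: [N.+1] is split as (N.+1 - q) + q, one part for each of the two factors. The terms
   [G], where a mode of [a] stands between the factors, cancel. *)
have -> : N.+1%:R *: \sum_(q < N.+2) Delta_mode u (N.+1 - q) m (E q v)
  = \sum_(q < N.+2) (N.+1 - q)%:R *: Delta_mode u (N.+1 - q) m (E q v)
    + \sum_(q < N.+2) q%:R *: Delta_mode u (N.+1 - q) m (E q v).
  rewrite -big_split scaler_sumr; apply: eq_bigr => -[q /= qN] _.
  by rewrite -scalerDl -natrD subnK.
rewrite [X in _ = _ + X]big_ord_recl [X in _ = _ + (X + _)]scale0r add0r.
rewrite [X in _ = X + _]big_ord_recr /= subnn [X in _ = _ + X + _]scale0r addr0.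
have -> : \sum_(i < N.+1) (lift ord0 i)%:R *: Delta_mode u (N.+1 - lift ord0 i) m (E
  (lift ord0 i) v)
   = \sum_(p < N.+1) \sum_(j < (N - p).+1) G j p.
  rewrite -exchange_triangle -triangle_diag; apply: eq_bigr => -[q /= qN] _.
  rewrite /bump /= add1n subSS -(linZ (Delta_mode_linear _ _ _)) Delta_coefS.
  rewrite (lin_sum (Delta_mode_linear _ _ _)); apply: eq_bigr => -[j /= jq] _.
  rewrite (linZ (Delta_mode_linear _ _ _)) /G; congr (_ *: Delta_mode _ _ _ _); lia.
rewrite (exchange_triangle (fun j q =>
  (- 1) ^+ j *: Y a j.+1%:Z (Delta_mode u (N - j - q) m (E q v)))).
rewrite -big_split; apply: eq_bigr => -[q /= qN] _.
rewrite subSn // Delta_mode_rec -big_split; apply: eq_bigr => -[j /= jN] _.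
rewrite /G scalerBr (_ : N - j - q = N - q - j)%N; last by lia.
by rewrite subrK.
Qed.
End Deformation.

Lemma uniform_bound (P : nat) (R : nat -> nat -> Prop) :
  (forall p, (p < P)%N -> exists N, forall B, (N <= B)%N -> R p B) ->
  exists N, forall p B, (p < P)%N -> (N <= B)%N -> R p B.
Proof.
elim: P => [|P IH] h; first by exists 0%N.
have [p pP|N1 h1] := IH; first by apply: h; lia.
have [N2 h2] := h P (ltnSn P).
exists (N1 + N2)%N => p B; rewrite ltnS leq_eqVlt => /predU1P[->|pP] hB.
  by apply: h2; lia.
by apply: h1 => //; lia.
Qed.

Lemma sum_diag_box (M : zmodType) (H : nat -> nat -> M) (B C : nat) :
  (forall q s, (B <= q)%N || (B <= s)%N -> H q s = 0) -> (2 * B <= C)%N ->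
  \sum_(c < C) \sum_(q < c.+1) H q (c - q)%N = \sum_(q < B) \sum_(s < B) H q s.
Proof.
move=> H0 BC; case: C BC => [|C] BC.
  by rewrite (_ : B = 0)%N ?big_ord0 //; lia.
rewrite triangle_diag (@sum_widen _ (fun j => \sum_(p < (C - j).+1) H j p) B).
- apply: eq_bigr => -[q /= qB] _; rewrite (@sum_widen _ (H q) B) //; first by lia.
  by move=> s Bs; rewrite H0 // Bs orbT.
- by lia.
- by move=> q Bq; rewrite big1 // => s _; rewrite H0 // Bq.
Qed.

(** * Li's twisted module *)

Section DeformedModule.
Variables (K : numFieldType) (V : lmodType K) (Y : V -> int -> V -> V) (one : V).
Hypothesis HY : weak_module_axioms Y one Y.
Variable a : V.
Hypothesis a0 : forall v, Y a 0 v = 0.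
Hypothesis a_one : forall j : nat, Y a j%:Z one = 0.
Local Notation g := (gbinom K).
Local Notation E := (Delta_coef Y a).
Hypothesis Delta_nil : forall u, exists P : nat, forall p, (P <= p)%N -> E p u = 0.
Variables (M : lmodType K) (act : V -> int -> M -> M).
Hypothesis H : weak_module_axioms Y one act.
Implicit Types (u v w : V) (l m n : int) (x : M).

(** The modes of Y(Delta(a, z) u, z): the power z^(-p) attached to [E p u] shifts the mode index by
    [p]. The sum is finite by [Delta_nil]. *)
Definition deformed_act u n x : M :=
  \sum_(p \in [set: nat]) act (E p u) (n - p%:Z) x.
Local Notation dact := deformed_act.

Lemma deformed_actE u n x P : (forall p, (P <= p)%N -> E p u = 0) ->
  dact u n x = \sum_(p < P) act (E p u) (n - p%:Z) x.
Proof. by move=> E0; apply: fsum_nat => p /E0 ->; rewrite (actl0 H). Qed.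

Lemma Delta_nil2 u v :
  exists P : nat, forall p, (P <= p)%N -> E p u = 0 /\ E p v = 0.
Proof.
have [P hP] := Delta_nil u; have [Q hQ] := Delta_nil v.
by exists (P + Q)%N => p hp; rewrite hP ?hQ //; lia.
Qed.

Lemma deformed_act_linl n x : linear (fun v => dact v n x).
Proof.
move=> c u v; have [P hP] := Delta_nil2 u v.
have Elin p := Delta_coef_linear HY a p.
rewrite !(@deformed_actE _ _ _ P) => [|p /hP[]|p /hP[]|p /hP[Eu Ev]] //.
  rewrite scaler_sumr -big_split; apply: eq_bigr => p _ /=.
  by rewrite (Elin p) (act_linl H).
by rewrite (Elin p) Eu Ev scaler0 addr0.
Qed.

Lemma deformed_act_linr v n : linear (dact v n).
Proof.
move=> c x y; have [P hP] := Delta_nil v; rewrite !(@deformed_actE _ _ _ P) //.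
rewrite scaler_sumr -big_split; apply: eq_bigr => p _ /=.
by rewrite (act_linr H).
Qed.

Lemma deformed_act_trunc v x : exists N : nat, forall n, N%:Z <= n -> dact v n x = 0.
Proof.
have [P hP] := Delta_nil v.
have [p pP|N hN] := @uniform_bound P (fun p N => act (E p v) N%:Z x = 0).
  have [N hN] := act_trunc H (E p v) x.
  by exists N => B NB; apply: hN; lia.
exists (N + P)%N => n hn; rewrite (deformed_actE n x hP) big1 // => -[p /= pP] _.
have -> : n - p%:Z = `|n - p%:Z|%N%:Z by lia.
by apply: hN => //; lia.
Qed.

Lemma Delta_coef_one p : E p.+1 one = 0.
Proof.
elim/ltn_ind: p => p IH; apply: (@scalerI _ _ p.+1%:R); first by rewrite pnatr_eq0.
rewrite scaler0 Delta_coefS big1 // => -[j /= jp] _.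
have [->|pj] := eqVneq p j; first by rewrite subnn a_one scaler0.
have -> : (p - j = (p - j).-1.+1)%N by lia.
by rewrite IH ?(act0 HY) ?scaler0 //; lia.
Qed.

Lemma deformed_act_one n x : dact one n x = if n == - 1 then x else 0.
Proof.
rewrite (@deformed_actE _ _ _ 1) => [|[|p] //]; last by rewrite Delta_coef_one.
by rewrite big_ord1 subr0 (act_one H).
Qed.

(** The conjugation formula yields a sum over the diagonals c = q + p + j; finite support allows the
    three indices to be cut independently at [B] instead. *)
Lemma deformed_act_mode u v x l k (B : nat) :
  (forall p, (B <= p)%N -> E p u = 0) -> (forall p, (B <= p)%N -> E p v = 0) ->
  (forall p q i : nat, (B <= i)%N -> Y (E p u) (l + i%:Z) (E q v) = 0) ->
  forall i : nat,
  dact (Y u (l + i%:Z) v) k x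
  = \sum_(q < B) \sum_(p < B) \sum_(j < B) g (- p%:Z) j *:
      act (Y (E p u) (l + (i + j)%N%:Z) (E q v)) (k - q%:Z - p%:Z - j%:Z) x.
Proof.
move=> Eu Ev W0 i.
pose W p q j := Y (E p u) (l + (i + j)%N%:Z) (E q v).
pose F q p j := g (- p%:Z) j *: act (W p q j) (k - q%:Z - p%:Z - j%:Z) x.
have Fq q p j : (B <= q)%N -> F q p j = 0.
  by move=> /Ev Eq; rewrite /F /W Eq (act0 HY) (actl0 H) scaler0.
have Fp q p j : (B <= p)%N -> F q p j = 0.
  by move=> /Eu Ep; rewrite /F /W Ep (actl0 HY) (actl0 H) scaler0.
have Fj q p j : (B <= j)%N -> F q p j = 0.
  by move=> hj; rewrite /F /W W0 ?(actl0 H) ?scaler0 //; lia.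
pose G q s := \sum_(p < s.+1) F q p (s - p)%N.
have G0 q s : (2 * B <= q)%N || (2 * B <= s)%N -> G q s = 0.
  move=> qs; rewrite /G big1 // => -[p /= ps] _.
  case/orP: qs => hqs; first by apply: Fq; lia.
  by have [/Fp//|pB] := leqP B p; apply: Fj; lia.
have EW c : E c (Y u (l + i%:Z) v) = \sum_(q < c.+1) \sum_(p < (c - q).+1)
    g (- p%:Z) (c - q - p) *: W p q (c - q - p)%N.
  rewrite (Delta_coef_mode HY a0); apply: eq_bigr => q _.
  by apply: eq_bigr => p _; rewrite /W PoszD addrA.
(* Nonzero terms have [q], [p] and [j] below [B], so the pairs (q, p + j) fit in a box of side
   [2 * B], and [sum_diag_box] asks for twice that side. *)
rewrite (@deformed_actE _ _ _ (4 * B)) => [|c hc]; last first.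
  rewrite EW big1 // => -[q /= qc] _; rewrite big1 // => -[p /= pq] _.
  have [/Ev Eq|qB] := leqP B q; first by rewrite /W Eq (act0 HY) scaler0.
  have [/Eu Ep|pB] := leqP B p; first by rewrite /W Ep (actl0 HY) scaler0.
  by rewrite /W W0 ?scaler0 //; lia.
transitivity (\sum_(c < 4 * B) \sum_(q < c.+1) G q (c - q)%N).
  apply: eq_bigr => -[c /= _] _; rewrite EW (actl_sum H).
  apply: eq_bigr => -[q /= qc] _; rewrite (actl_sum H).
  apply: eq_bigr => -[p /= pq] _; rewrite (actlZ H) /F; congr (_ *: act _ _ _); lia.
rewrite (sum_diag_box G0) //; last by lia.
rewrite (@sum_widen _ (fun q => \sum_(s < 2 * B) G q s) B); last 2 first.
- by lia.
- by move=> q Bq; rewrite big1 // => s _; rewrite /G big1 // => p _; apply: Fq.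
apply: eq_bigr => -[q /= qB] _; rewrite (@sum_diag_box _ (F q) B) //.
by move=> p j /orP[/Fp->|/Fj->].
Qed.

(** For fixed [p] and [q], Vandermonde's identity merges the binomials of [m] and [- p] into that of
    [m - p]. What remains is the Jacobi identity of [act] for [E p u] and [E q v] with parameters
    [m - p] and [n - q], summed over [p] and [q]. *)
Lemma deformed_jacobi u v x l m n :
  \sum_(i \in [set: nat]) g m i *: dact (Y u (l + i%:Z) v) (m + n - i%:Z) x
  = \sum_(i \in [set: nat]) jacobi_term dact u v x l m n i.
Proof.
have [P hP] := Delta_nil2 u v.
pose W p q i := Y (E p u) (l + i%:Z) (E q v).
have [N hN] : exists N, forall p B, (p < P)%N -> (N <= B)%N ->
    forall q, (q < P)%N -> W p q B = 0.
  apply: uniform_bound => p _.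
  have [q _|N hN] := @uniform_bound P (fun q B => W p q B = 0).
    have [N hN] := act_trunc HY (E p u) (E q v).
    by exists (N + `|l|)%N => B hB; apply: hN; lia.
  by exists N => B hB q hq; apply: hN.
pose B := (P + N)%N.
have Eu p : (B <= p)%N -> E p u = 0 by move=> hp; apply hP; lia.
have Ev p : (B <= p)%N -> E p v = 0 by move=> hp; apply hP; lia.
have W0 p q i : (B <= i)%N -> W p q i = 0.
  move=> hi; have [/hP[Ep _]|pP] := leqP P p; first by rewrite /W Ep (actl0 HY).
  have [/hP[_ Eq]|qP] := leqP P q; first by rewrite /W Eq (act0 HY).
  by apply: hN => //; lia.
pose A p q i := act (W p q i) (m - p%:Z + (n - q%:Z) - i%:Z) x.
have A0 p q i : (B <= i)%N -> A p q i = 0 by move=> /W0; rewrite /A => ->;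
  rewrite (actl0 H).
transitivity (\sum_(q < B) \sum_(p < B) \sum_(i < 2 * B) g (m - p%:Z) i *: A p q i).
  rewrite (@fsum_nat _ _ B) => [|i iB]; last first.
    rewrite (deformed_act_mode _ _ Eu Ev W0) big1 ?scaler0 // => q _.
    rewrite big1 // => p _; rewrite big1 // => j _.
    by rewrite -/(W _ _ _) W0 ?(actl0 H) ?scaler0 //; lia.
  transitivity (\sum_(i < B) \sum_(q < B) \sum_(p < B) \sum_(j < B)
     (g m i * g (- p%:Z) j) *: A p q (i + j)%N).
    apply: eq_bigr => i _; rewrite (deformed_act_mode _ _ Eu Ev W0).
    rewrite !scaler_sumr; apply: eq_bigr => q _.
    rewrite !scaler_sumr; apply: eq_bigr => p _.
    rewrite !scaler_sumr; apply: eq_bigr => j _.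
    by rewrite scalerA /A /W; congr (_ *: act _ _ _); lia.
  rewrite exchange_big; apply: eq_bigr => q _.
  rewrite exchange_big; apply: eq_bigr => p _.
  pose B2 := (2 * B)%N.
  transitivity (\sum_(i < B2) \sum_(j < B2) (g m i * g (- p%:Z) j) *: A p q (i + j)%N).
    rewrite [RHS](@sum_widen _ (fun i =>
      \sum_(j < B2) (g m i * g (- p%:Z) j) *: A p q (i + j)%N) B); last 2 first.
    - by lia.
    - by move=> i Bi; rewrite big1 // => j _; rewrite A0 ?scaler0 //; lia.
    apply: eq_bigr => i _.
    rewrite [RHS](@sum_widen _ (fun j =>
      (g m i * g (- p%:Z) j) *: A p q (i + j)%N) B) //.
      by lia.
    by move=> j Bj; rewrite A0 ?scaler0 //; lia.
  rewrite -(@sum_diag_box _ (fun i j =>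
    (g m i * g (- p%:Z) j) *: A p q (i + j)%N) B2 (2 * B2)) //.
    rewrite (@sum_widen _ (fun c =>
      \sum_(i < c.+1) (g m i * g (- p%:Z) (c - i)) *: A p q (i + (c - i))%N) B2);
        last 2 first.
    - by lia.
    - by move=> c hc; rewrite big1 // => -[i /= ic] _; rewrite A0 ?scaler0 //; lia.
    apply: eq_bigr => c _; rewrite gbinom_vandermonde scaler_suml.
    by apply: eq_bigr => -[i /= ic] _; rewrite subnKC.
  by move=> i j ij; rewrite A0 ?scaler0 //; case/orP: ij; lia.
have [N1 hN1] := deformed_act_trunc v x.
have [N2 hN2] := deformed_act_trunc u x.
have [N3 hN3] : exists N3, forall q C, (q < B)%N -> (N3 <= C)%N ->
    forall p, (p < B)%N ->
    \sum_(i < C) g (m - p%:Z) i *: A p q i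
    = \sum_(i < C) jacobi_term act (E p u) (E q v) x l (m - p%:Z) (n - q%:Z) i.
  apply: uniform_bound => q _.
  have [p _|N' hN'] := @uniform_bound B (fun p C => 
    \sum_(i < C) g (m - p%:Z) i *: A p q i
    = \sum_(i < C) jacobi_term act (E p u) (E q v) x l (m - p%:Z) (n - q%:Z) i).
    exact: jacobi_sum HY _ _ H _ _ _ _ _ _.
  by exists N' => C hC p hp; apply: hN'.
pose C := (2 * B + N1 + N2 + N3 + `|m| + `|n|)%N.
rewrite [RHS](@fsum_nat _ _ C) => [|i iC]; last first.
  rewrite /jacobi_term hN1; last by lia.
  rewrite hN2; last by lia.
  by rewrite !(lin0 (deformed_act_linr _ _)) scaler0 subr0 scaler0.
transitivity (\sum_(q < B) \sum_(p < B) \sum_(i < C)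
   jacobi_term act (E p u) (E q v) x l (m - p%:Z) (n - q%:Z) i).
  apply: eq_bigr => -[q /= qB] _; apply: eq_bigr => -[p /= pB] _.
  rewrite -hN3 //; last by lia.
  rewrite [RHS](@sum_widen _ (fun i => g (m - p%:Z) i *: A p q i) (2 * B)) //;
    first by lia.
  by move=> i hi; rewrite A0 ?scaler0 //; lia.
under eq_bigr => q _ do rewrite exchange_big /=.
rewrite exchange_big; apply: eq_bigr => i _ /=.
rewrite /jacobi_term.
under eq_bigr => q _ do rewrite -scaler_sumr.
rewrite -scaler_sumr; congr (_ *: _).
under eq_bigr => q _ do rewrite sumrB.
rewrite sumrB; congr (_ - _).
  rewrite (deformed_actE _ _ Ev) (lin_sum (deformed_act_linr _ _)).
  apply: eq_bigr => q _; rewrite (deformed_actE _ _ Eu).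
  by apply: eq_bigr => p _; congr (act _ _ (act _ _ _)); lia.
under eq_bigr => q _ do rewrite -scaler_sumr.
rewrite -scaler_sumr; congr (_ *: _).
rewrite (deformed_actE _ _ Ev); apply: eq_bigr => q _.
rewrite (deformed_actE _ _ Eu) (act_sum H).
by apply: eq_bigr => p _; congr (act _ _ (act _ _ _)); lia.
Qed.

Lemma deformed_module : weak_module_axioms Y one dact.
Proof.
split.
- by split; [exact: deformed_act_linl|exact: deformed_act_linr].
- move=> v x; have [N hN] := deformed_act_trunc v x.
  by exists N%:Z => n /hN.
- exact: deformed_act_one.
- exact: deformed_jacobi.
Qed.

End DeformedModule.

(** * Submodules, quotients and gradings *)

Section QuotientSpace.
Variables (F : numFieldType) (M : lmodType F) (K : set M).
Hypothesis Ks : is_subspace K.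

Definition coset_pred (x : M) : pred M := fun y => `[< K (x - y) >].
Definition coset_repr (x : M) : M := choose (coset_pred x) x.

Lemma coset_reprP x : K (x - coset_repr x).
Proof.
by apply/asboolP/(@chooseP _ (coset_pred x)); apply/asboolP; rewrite subrr;
  apply: subspace0 Ks.
Qed.

Lemma coset_repr_eq x y : K (x - y) -> coset_repr x = coset_repr y.
Proof.
move=> Kxy; have e : coset_pred x = coset_pred y.
  apply/funext => z; apply/asboolP/asboolP => h.
    by rewrite (_ : y - z = (x - z) - (x - y));
      [apply: subspaceB|rewrite opprB [RHS]addrC addrA subrK].
  by rewrite (_ : x - z = (x - y) + (y - z)); [apply: subspaceD|rewrite addrA subrK].
rewrite /coset_repr e; apply: choose_id; apply/asboolP.
  by rewrite -opprB; apply: subspaceN.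
by rewrite subrr; apply: subspace0 Ks.
Qed.

Lemma coset_repr_idem x : coset_repr (coset_repr x) == coset_repr x.
Proof. by apply/eqP/esym/coset_repr_eq/coset_reprP. Qed.

(** The carrier consists of coset representatives picked by choice. The proof that [K] is a subspace
    is an argument of the type, so that the algebraic instances can be attached to it. *)
Definition quotient_space of is_subspace K := {x : M | coset_repr x == x}.
Local Notation Q := (quotient_space Ks).
HB.instance Definition _ := Choice.on Q.

Definition qproj (x : M) : Q :=
  exist _ (coset_repr x) (coset_repr_idem x).

Lemma qproj_eq x y : K (x - y) -> qproj x = qproj y.
Proof. by move=> /coset_repr_eq h; apply: val_inj. Qed.

Lemma qproj_val (x : Q) : qproj (val x) = x.
Proof. by apply: val_inj; apply/eqP: (valP x). Qed.

Lemma qproj_inj x y : qproj x = qproj y -> K (x - y).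
Proof.
move=> [e]; have := coset_reprP x; rewrite e => Kx.
rewrite (_ : x - y = (x - coset_repr y) - (y - coset_repr y)).
  by apply: subspaceB => //; apply: coset_reprP.
by rewrite opprB addrA subrK.
Qed.

Definition qadd (x y : Q) := qproj (val x + val y).
Definition qopp (x : Q) := qproj (- val x).
Definition qscale (c : F) (x : Q) := qproj (c *: val x).

Lemma qprojD x y : qproj (x + y) = qadd (qproj x) (qproj y).
Proof.
apply: qproj_eq; rewrite opprD addrACA.
by apply: subspaceD => //; apply: coset_reprP.
Qed.

Lemma qprojZ c x : qproj (c *: x) = qscale c (qproj x).
Proof. by apply: qproj_eq; rewrite -scalerBr; apply: subspaceZ => //;
  apply: coset_reprP. Qed.

Lemma qprojN x : qproj (- x) = qopp (qproj x).
Proof.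
by apply: qproj_eq; rewrite -opprD; apply: subspaceN => //; apply: coset_reprP.
Qed.

Lemma qproj_ind (P : Q -> Prop) : (forall x, P (qproj x)) -> forall y, P y.
Proof. by move=> h y; rewrite -(qproj_val y). Qed.

Lemma qaddA : associative qadd.
Proof.
elim/qproj_ind => x; elim/qproj_ind => y; elim/qproj_ind => z.
by rewrite -!qprojD addrA.
Qed.
Lemma qaddC : commutative qadd.
Proof. by move=> x y; rewrite /qadd addrC. Qed.
Lemma qadd0 : left_id (qproj 0) qadd.
Proof. by elim/qproj_ind => x; rewrite -qprojD add0r. Qed.
Lemma qaddN : left_inverse (qproj 0) qopp qadd.
Proof. by elim/qproj_ind => x; rewrite -qprojN -qprojD addNr. Qed.

HB.instance Definition _ := GRing.isZmodule.Build Q qaddA qaddC qadd0 qaddN.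

Lemma qscaleA c d x : qscale c (qscale d x) = qscale (c * d) x.
Proof. by elim/qproj_ind: x => x; rewrite -!qprojZ scalerA. Qed.
Lemma qscale1 : left_id 1 qscale.
Proof. by elim/qproj_ind => x; rewrite -!qprojZ scale1r. Qed.
Lemma qscaleDr : right_distributive qscale +%R.
Proof.
move=> c; elim/qproj_ind => x; elim/qproj_ind => y.
by rewrite -[_ + _]qprojD -!qprojZ scalerDr qprojD.
Qed.
Lemma qscaleDl x : {morph qscale^~ x : c d / c + d}.
Proof. by elim/qproj_ind: x => x c d; rewrite -!qprojZ scalerDl qprojD. Qed.

HB.instance Definition _ :=
  GRing.Zmodule_isLmodule.Build F Q qscaleA qscale1 qscaleDr qscaleDl.

Lemma qproj_linear : linear qproj.
Proof. by move=> c x y; rewrite qprojD qprojZ. Qed.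

End QuotientSpace.

Section SubSpace.
Variables (F : numFieldType) (M : lmodType F) (P : set M).
Hypothesis Ps : is_subspace P.

Definition sub_space of is_subspace P := {x : M | `[< P x >]}.
Local Notation S := (sub_space Ps).
HB.instance Definition _ := Choice.on S.

Definition to_sub (x : M) (Px : P x) : S := exist _ x (asboolT Px).
Lemma sub_valP (x : S) : P (val x).
Proof. exact/asboolP/(valP x). Qed.

Definition sadd (x y : S) := to_sub (subspaceD Ps (sub_valP x) (sub_valP y)).
Definition sopp (x : S) := to_sub (subspaceN Ps (sub_valP x)).
Definition sscale (c : F) (x : S) := to_sub (subspaceZ Ps c (sub_valP x)).

Lemma saddA : associative sadd.
Proof. by move=> x y z; apply: val_inj; rewrite /= addrA. Qed.
Lemma saddC : commutative sadd.
Proof. by move=> x y; apply: val_inj; rewrite /= addrC. Qed.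
Lemma sadd0 : left_id (to_sub (subspace0 Ps)) sadd.
Proof. by move=> x; apply: val_inj; rewrite /= add0r. Qed.
Lemma saddN : left_inverse (to_sub (subspace0 Ps)) sopp sadd.
Proof. by move=> x; apply: val_inj; rewrite /= addNr. Qed.

HB.instance Definition _ := GRing.isZmodule.Build S saddA saddC sadd0 saddN.

Lemma sscaleA c d x : sscale c (sscale d x) = sscale (c * d) x.
Proof. by apply: val_inj; rewrite /= scalerA. Qed.
Lemma sscale1 : left_id 1 sscale.
Proof. by move=> x; apply: val_inj; rewrite /= scale1r. Qed.
Lemma sscaleDr : right_distributive sscale +%R.
Proof. by move=> c x y; apply: val_inj; rewrite /= scalerDr. Qed.
Lemma sscaleDl x : {morph sscale^~ x : c d / c + d}.
Proof. by move=> c d; apply: val_inj; rewrite /= scalerDl. Qed.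

HB.instance Definition _ :=
  GRing.Zmodule_isLmodule.Build F S sscaleA sscale1 sscaleDr sscaleDl.

End SubSpace.

Section WeakModuleIntro.
Variables (K : numFieldType) (V : lmodType K) (Y : V -> int -> V -> V) (one : V).
Hypothesis HY : weak_module_axioms Y one Y.
Variables (M : lmodType K) (act : V -> int -> M -> M).

(** Lets the Jacobi identity be checked on truncated sums, which commute with linear maps. In this
    form it passes to quotients and submodules. *)
Lemma weak_module_intro :
  (forall n x, linear (fun v => act v n x)) ->
  (forall v n, linear (act v n)) ->
  (forall v x, exists N : nat, forall n, N%:Z <= n -> act v n x = 0) ->
  (forall n x, act one n x = if n == - 1 then x else 0) ->
  (forall u v x l m n, exists B0 : nat, forall B, (B0 <= B)%N ->
    \sum_(i < B) gbinom K m i *: act (Y u (l + i%:Z) v) (m + n - i%:Z) x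
    = \sum_(i < B) jacobi_term act u v x l m n i) ->
  weak_module_axioms Y one act.
Proof.
move=> Hl Hr Ht H1 HJ; split => [//|v x|//|u v x l m n].
  by have [N hN] := Ht v x; exists N%:Z.
have [N1 N1P] := act_trunc HY u v.
have [N2 N2P] := Ht v x.
have [N3 N3P] := Ht u x.
have [B0 B0P] := HJ u v x l m n.
pose B := (B0 + N1 + N2 + N3 + `|l| + `|m| + `|n|)%N.
rewrite (@fsum_nat _ _ B) => [|i iB]; last first.
  by rewrite N1P ?(lin0 (Hl _ _)) ?scaler0 //; lia.
rewrite (@fsum_nat _ (jacobi_term act u v x l m n) B) => [|i iB].
  by apply: B0P; lia.
by rewrite /jacobi_term N2P ?N3P ?(lin0 (Hr _ _)) ?scaler0 ?subr0 ?scaler0 //; lia.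
Qed.

End WeakModuleIntro.

Section SubQuotients.
Variables (R : realType) (V : voa R) (M : vmodule V).
Local Notation C := R[i].
Local Notation HV := (voa_jacobi V).
Local Notation HM := (vmodule_axioms M).

Lemma jacobi_map (N : lmodType C) (f : M -> N) (actN : V -> int -> N -> N) :
  linear f -> (forall v n x, f (act v n x) = actN v n (f x)) ->
  forall u v x l m n (B : nat),
  (f (\sum_(i < B) gbinom C m i *: act (mode u (l + i%:Z) v) (m + n - i%:Z) x)
   = \sum_(i < B) gbinom C m i *: actN (mode u (l + i%:Z) v) (m + n - i%:Z) (f x))
  * (f (\sum_(i < B) jacobi_term (@act _ _ M) u v x l m n i)
     = \sum_(i < B) jacobi_term actN u v (f x) l m n i).
Proof.
move=> fl fa u v x l m n B; split; rewrite (lin_sum fl); apply: eq_bigr => i _.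
  by rewrite (linZ fl) fa.
by rewrite (linZ fl) (linB fl) (linZ fl) !fa.
Qed.

Lemma quotient_module (K : set M) : is_submodule K ->
  exists (Q : vmodule V) (f : M -> Q),
    [/\ module_hom f, forall y, exists x, f x = y & forall x, f x = 0 <-> K x].
Proof.
move=> [Ks Ka]; pose f := qproj Ks.
have fl : linear f := qproj_linear Ks.
pose a v n (y : quotient_space Ks) := f (act v n (val y)).
have fa v n x : f (act v n x) = a v n (f x).
  apply: qproj_eq; rewrite -(actB HM); apply: Ka.
  by apply: (@qproj_inj _ _ _ Ks); rewrite qproj_val.
have Ha : weak_module_axioms (@mode R V) (vacuum V) a.
  apply: (weak_module_intro HV).
  - move=> n; elim/qproj_ind => x c u v; rewrite -!fa.
    by rewrite (act_linl HM) fl.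
  - move=> v n c; elim/qproj_ind => x; elim/qproj_ind => y.
    by rewrite -fl -!fa (act_linr HM) fl.
  - move=> v; elim/qproj_ind => x; have [N hN] := act_trunc HM v x.
    by exists N => n /hN e; rewrite -fa e (lin0 fl).
  - move=> n; elim/qproj_ind => x; rewrite -fa (act_one HM).
    by case: ifP => // _; rewrite (lin0 fl).
  move=> u v; elim/qproj_ind => x l m n; have [B0 hB] := jacobi_sum HV HM u v x l m n.
  by exists B0 => B /hB /(congr1 f); rewrite !(jacobi_map fl fa).
exists (VModule Ha), f; split; first by [].
  by move=> y; exists (val y); apply: qproj_val.
move=> x; split=> [|Kx].
  by rewrite -(lin0 fl) => /(@qproj_inj _ _ _ Ks); rewrite subr0.
by rewrite -(lin0 fl); apply: qproj_eq; rewrite subr0.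
Qed.

Lemma sub_module (P : set M) : is_submodule P ->
  exists (S : vmodule V) (f : S -> M),
    [/\ module_hom f, injective f & forall x, P x <-> exists y, f y = x].
Proof.
move=> [Ps Pa]; pose f (x : sub_space Ps) : M := val x.
have fl : linear f by [].
have fi : injective f := val_inj.
pose a v n (y : sub_space Ps) : sub_space Ps := to_sub Ps (Pa v n _ (sub_valP y)).
have fa v n x : f (a v n x) = act v n (f x) by [].
have Ha : weak_module_axioms (@mode R V) (vacuum V) a.
  apply: (weak_module_intro HV).
  - by move=> n x c u v; apply: fi; rewrite fl !fa (act_linl HM).
  - by move=> v n c x y; apply: fi; rewrite fl !fa fl (act_linr HM).
  - move=> v x; have [N hN] := act_trunc HM v (f x).
    by exists N => n /hN e; apply: fi; rewrite fa e.
  - by move=> n x; apply: fi; rewrite fa (act_one HM); case: ifP.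
  move=> u v x l m n; have [B0 hB] := jacobi_sum HV HM u v (f x) l m n.
  exists B0 => B /hB e; apply: fi; rewrite !(lin_sum fl).
  transitivity (\sum_(i < B) gbinom C m i *: act (mode u (l + i%:Z) v) (m + n - i%:Z)
    (f x)).
    by apply: eq_bigr.
  by rewrite e; apply: eq_bigr.
exists (VModule Ha), f; split => // x; split=> [Px|[y <-]]; last exact: sub_valP.
by exists (to_sub Ps Px).
Qed.

End SubQuotients.

(** * Gradings given by projections *)

Section Gradings.
Variables (F : numFieldType).

(** The projections are data here, so that graded submodules are those stable under [p] and graded
    maps those commuting with it. *)
Definition grading (M : lmodType F) (A : nat -> set M) (p : nat -> M -> M) : Prop :=
  [/\ forall n, is_subspace (A n), forall n, linear (p n),
      forall n x, A n (p n x),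
      forall m n x, A n x -> p m x = if m == n then x else 0
    & forall x, exists N, forall B, (N <= B)%N -> x = \sum_(n < B) p n x].

Lemma nat_finite_bounded (S : set nat) : finite_set S ->
  exists N, forall n, S n -> (n < N)%N.
Proof.
move=> /finite_seqP[s ->]; exists (\max_(i <- s) i).+1 => n /= ns.
by rewrite ltnS (big_rem n ns) leq_maxl.
Qed.

Lemma direct_sum_grading (M : lmodType F) (A : nat -> set M) :
  is_direct_sum A <-> exists p, grading A p.
Proof.
split.
  move=> [As Ad]; pose f x := sval (cid (Ad x)).
  have fP x : decomposes A x (f x) by rewrite /f; case: cid => g [].
  have fU x g : decomposes A x g -> g = f x.
    by rewrite /f => hg; case: cid => h [hh hU] /=; rewrite (hU _ hg).
  have fB x : exists N, forall n, (N <= n)%N -> f x n = 0.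
    have [_ /nat_finite_bounded[N hN] _] := fP x.
    by exists N => n nN; apply/eqP/negPn/negP => /hN; rewrite ltnNge nN.
  have decI x g N : (forall n, A n (g n)) -> (forall n, (N <= n)%N -> g n = 0) ->
      x = \sum_(n < N) g n -> g = f x.
    move=> Ag g0 xg; apply: fU; split => //; last by rewrite (fsum_nat g0).
    apply: (@sub_finite_set _ _ `I_N); last exact: finite_II.
    by move=> n /= gn; rewrite ltnNge; apply/negP => /g0 e; rewrite e eqxx in gn.
  have fsumN x N : (forall n, (N <= n)%N -> f x n = 0) -> x = \sum_(n < N) f x n.
    by move=> /fsum_nat <-; have [] := fP x.
  exists (fun n x => f x n); split => //.
  - move=> n c x y; have [Nx hx] := fB x; have [Ny hy] := fB y.
    pose N := maxn Nx Ny.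
    have hx' k : (N <= k)%N -> f x k = 0 by move=> h; apply: hx; lia.
    have hy' k : (N <= k)%N -> f y k = 0 by move=> h; apply: hy; lia.
    rewrite -(@decI (c *: x + y) (fun k => c *: f x k + f y k) N) //.
    + by move=> k; apply: (subspaceD (As k)); [apply: (subspaceZ (As k))|];
      have [] := fP x; have [] := fP y.
    + by move=> k h; rewrite hx' ?hy' // scaler0 addr0.
    + by rewrite big_split /= -scaler_sumr -!fsumN.
  - by move=> n x; have [] := fP x.
  - move=> m n x Ax; rewrite -(@decI x (fun k => if k == n then x else 0) n.+1) //.
    + by move=> k; case: eqP => [->|_] //; apply: subspace0.
    + by move=> k h; case: eqP => // e; lia.
    + by rewrite big_ord_recr /= eqxx big1 ?add0r // => -[k /= kn] _;
      case: eqP => // e; lia.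
  - move=> x; have [N hN] := fB x; exists N => B NB.
    by apply: fsumN => n h; apply: hN; lia.
move=> [p [As pl Ap pA pB]]; split => // x; have [N hN] := pB x.
have p0 n : (N <= n)%N -> p n x = 0.
  (* The partial sums of lengths [n] and [n.+1] both equal [x], so the component of degree [n] is
     zero. *)
  move=> h; have e1 := hN n h; have := hN n.+1 (leqW h).
  by rewrite big_ord_recr /= -e1 => e2; apply: (addrI x); rewrite -e2 addr0.
have fin (f : nat -> M) B : (forall n, (B <= n)%N -> f n = 0) -> finite_set [set i |
  f i != 0].
  move=> f0; apply: (@sub_finite_set _ _ `I_B); last exact: finite_II.
  by move=> n /= gn; rewrite ltnNge; apply/negP => /f0 e; rewrite e eqxx in gn.
exists (p^~ x); split.
  by split => //; [exact: fin p0|rewrite (fsum_nat p0); apply: hN].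
move=> g [Ag /nat_finite_bounded[B hB] xg]; apply/funext => m.
have g0 n : (B <= n)%N -> g n = 0.
  by move=> h; apply/eqP/negPn/negP => /hB; rewrite ltnNge h.
rewrite xg (fsum_nat g0) (lin_sum (pl m)).
have [mB|mB] := ltnP m B.
  rewrite (bigD1 (Ordinal mB)) //= (pA _ m) // eqxx big1 ?addr0 // => i im.
  rewrite (pA _ i) //; case: eqP => // e; case/eqP: im; exact: val_inj.
rewrite g0 // big1 // => -[i /= ib] _; rewrite (pA _ i) //; case: eqP => // e; lia.
Qed.

End Gradings.

(** * Vacuum-like vectors *)

Lemma sum_single (W : zmodType) (f : nat -> W) (B i0 : nat) : (i0 < B)%N ->
  (forall i, i != i0 -> f i = 0) -> \sum_(i < B) f i = f i0.
Proof.
move=> iB f0; rewrite (bigD1 (Ordinal iB)) //= big1 ?addr0 // => i ii.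
by apply: f0; apply: contra ii => /eqP e; apply/eqP/val_inj.
Qed.

Section VertexAlgebra.
Variables (R : realType) (V : voa R).
Local Notation C := R[i].
Local Notation HV := (voa_jacobi V).
Local Notation one := (vacuum V).
Local Notation om := (conformal V).
Implicit Types (u v w : V) (l m n k : int).

Lemma mode_vacuumN1 v : mode v (- 1) one = v.
Proof. by case: (voa_creation v). Qed.

Lemma mode_vacuum v (n : nat) : mode v n%:Z one = 0.
Proof. by case: (voa_creation v) => _; apply. Qed.

Lemma translation_mode v : mode om 0 v = mode v (- 2) one.
Proof.
by have := voa_derivative v one (- 1); rewrite mode_vacuumN1 scaleN1r opprK.
Qed.

Lemma weightP k v : weight_space k v -> mode om 1 v = k%:~R *: v.
Proof. by []. Qed.

Lemma weight_vacuum : weight_space 0 one.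
Proof. by rewrite /weight_space /Lop /= scale0r; apply: (mode_vacuum om 1). Qed.

(** The conformal vector is L(-2) 1, so this is the bracket of L(0) and L(-2) on the vacuum, where
    no central term appears. *)
Lemma weight_conformal : weight_space 2 om.
Proof.
have := @voa_virasoro R V 0 (- 2) one; rewrite /= /weight_space /Lop /=.
have -> : mode om (Negz 0) one = om by exact: mode_vacuumN1.
rewrite -[0 + 1]/(1%N%:Z) mode_vacuum (act0 HV) subr0 addr0 => ->.
by [].
Qed.

Section Modules.
Variable M : vmodule V.
Local Notation HM := (vmodule_axioms M).
Implicit Types x y : M.

(** The axioms assert this for [V] itself only. On a module it follows from L(-1) v = v_(-2) 1 and
    the iterate formula: the vacuum has a single nonzero mode, so at most one summand survives. *)
Lemma act_translation v n x :
  act (mode om 0 v) n x = - (n%:~R *: act v (n - 1) x).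
Proof.
rewrite translation_mode.
have [B0 hB] := iterate HV HM v one x (- 2) n.
pose B := (B0 + `|n|).+1; rewrite (hB B); last by lia.
have g2 i : (- 1) ^+ i * gbinom C (- 2) i = i.+1%:R.
  rewrite -(gbinom_reflect C 1 i) mulrA -expr2 sqrr_sign mul1r gbinom1.
  by rewrite add1n.
pose G (i : nat) := i.+1%:R *:
  (act v (- 2 - i%:Z) (if n + i%:Z == - 1 then x else 0)
   - (if n - 2 - i%:Z == - 1 then act v i%:Z x else 0)).
transitivity (\sum_(i < B) G i).
  apply: eq_bigr => i _; rewrite /jacobi_term g2 !(act_one HM) !add0r.
  by rewrite (_ : (- 1) ^ (- 2) = 1 :> C) ?scale1r // expN1r sqrrN expr1n.
have [n0|n0|n0] := ltgtP n 0.
- rewrite (@sum_single _ G B (absz (n + 1))); last 2 first.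
  + by lia.
  + move=> i /eqP ni; rewrite /G !ifF ?(act0 HM) ?subr0 ?scaler0 //; apply/eqP; lia.
  rewrite /G ifT; last by apply/eqP; lia.
  rewrite ifF; last by apply/eqP; lia.
  rewrite subr0 -scaleNr -rmorphN (_ : (absz (n + 1)).+1%:R = (- n)%:~R).
    by congr (_ *: act _ _ _); lia.
  rewrite pmulrn; congr (_%:~R); lia.
- rewrite (@sum_single _ G B (absz (n - 1))); last 2 first.
  + by lia.
  + move=> i /eqP ni; rewrite /G !ifF ?(act0 HM) ?subr0 ?scaler0 //; apply/eqP; lia.
  rewrite /G ifF; last by apply/eqP; lia.
  rewrite ifT; last by apply/eqP; lia.
  rewrite (act0 HM) sub0r scalerN (_ : (absz (n - 1)).+1%:R = n%:~R).
    by congr (- (_ *: act _ _ _)); lia.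
  rewrite pmulrn; congr (_%:~R); lia.
rewrite (_ : n%:~R = 0 :> C) ?n0 // scale0r oppr0 big1 // => i _; rewrite /G.
by rewrite !ifF ?(act0 HM) ?subr0 ?scaler0 //; apply/eqP; lia.
Qed.

Lemma translation_comm v n x :
  act om 0 (act v n x) = act v n (act om 0 x) - n%:~R *: act v (n - 1) x.
Proof. by rewrite (commutator0 HV HM) act_translation. Qed.

Lemma L0_comm k v n x : weight_space k v ->
  act om 1 (act v n x) = act v n (act om 1 x) + (k - n - 1)%:~R *: act v n x.
Proof.
move=> kv; rewrite (commutator1 HV HM) act_translation (weightP kv) (actlZ HM) addrK.
by rewrite -addrA -scaleNr -scalerDl -rmorphN -rmorphD; congr (_ + _%:~R *: _); lia.
Qed.

(** Descent from the truncation bound: applying L(-1) to v_n x = 0 gives n v_(n-1) x = 0, which can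
    be divided by n until n reaches 0. *)
Lemma vacuum_like v x (n : nat) : act om 0 x = 0 -> act v n%:Z x = 0.
Proof.
move=> Dx; have [N hN] := act_trunc HM v x.
suff h d : act v ((N - d)%N%:Z) x = 0.
  have [nN|Nn] := leqP n N; first by rewrite -(subKn nN).
  by apply: hN; lia.
elim: d => [|d IH]; first by rewrite subn0 hN.
have [Nd|dN] := leqP N d; first by rewrite (_ : N - d.+1 = N - d)%N //; lia.
have := translation_comm v (N - d)%N%:Z x; rewrite IH Dx !(act0 HM) sub0r.
move/eqP; rewrite eq_sym oppr_eq0 scaler_eq0 intr_eq0 => /orP[/eqP|/eqP]; first by lia.
by move=> <-; congr (act _ _ _); lia.
Qed.

(** Nonnegative modes kill [x], so only the first term of the iterate formula survives. *)
Lemma vacuum_like_jacobi u v x l : act om 0 x = 0 ->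
  act (mode u l v) (- 1) x = act u l (act v (- 1) x).
Proof.
move=> Dx; have [B0 hB] := iterate HV HM u v x l (- 1).
rewrite (hB B0.+1) // big_ord_recl big1 => [|i _].
  rewrite /jacobi_term /= gbinom0 mulr1 ?expr0 scale1r !add0r !subr0 addr0.
  by rewrite (@vacuum_like u x 0 Dx) (act0 HM) scaler0 subr0.
rewrite /jacobi_term lift0 !add0r (@vacuum_like u x i.+1 Dx) (act0 HM) scaler0 subr0.
rewrite (_ : - 1 + i.+1%:Z = i%:Z); last by lia.
by rewrite (@vacuum_like v x i Dx) !(act0 HM) scaler0.
Qed.

Lemma vacuum_like_hom x : act om 0 x = 0 ->
  @module_hom R V (adjoint_module V) M (fun v => act v (- 1) x).
Proof.
move=> Dx; split; first exact: (act_linl HM).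
by move=> u n v; apply: vacuum_like_jacobi.
Qed.

End Modules.

Lemma weight_mode k k' u v n : weight_space k u -> weight_space k' v ->
  weight_space (k + k' - n - 1) (mode u n v).
Proof.
move=> ku kv; have e : mode om 1 (mode u n v)
    = mode u n (mode om 1 v) + (k - n - 1)%:~R *: mode u n v.
  exact: (@L0_comm (adjoint_module V) k u n v ku).
rewrite /weight_space /Lop /= -[0 + 1]/(1 : int) e (weightP kv) (actZ HV) -scalerDl
  -rmorphD /=.
by congr (_%:~R *: _); lia.
Qed.

End VertexAlgebra.

(** * Graded modules and cyclic submodules *)

Section GradedModules.
Variables (R : realType) (V : voa R).
Hypothesis cft : cft_type V.
Local Notation C := R[i].
Local Notation HV := (voa_jacobi V).
Local Notation one := (vacuum V).
Local Notation om := (conformal V).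
Implicit Types (u v w : V) (l k : int).

Lemma weight_grading : exists p, grading (fun n : nat => @weight_space R V n%:Z) p.
Proof. by apply/direct_sum_grading; case: cft. Qed.

Lemma homogeneous_sum v : exists N (f : nat -> V),
  (forall n : nat, weight_space n%:Z (f n)) /\ v = \sum_(n < N) f n.
Proof.
have [p [_ _ pA _ /(_ v)[N hN]]] := weight_grading.
by exists N, (p^~ v); split => //; apply: hN.
Qed.

(** The decomposition of [V] runs over natural weights and its projections commute with L(0), so
    every component of an eigenvector with negative eigenvalue vanishes. *)
Lemma weight_ge0 k v : weight_space k v -> v != 0 -> 0 <= k.
Proof.
move=> kv v0; rewrite leNgt; apply/negP => k0; move/eqP: v0; apply.
have [p [As pl pA pp pB]] := weight_grading.
have [N hN] := pB v; rewrite (hN N) // big1 // => -[n /= _] _.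
have pL x : p n (mode om 1 x) = n%:Z%:~R *: p n x.
  have [N' hN'] := pB x.
  rewrite {1}(hN' (N' + n.+1)%N) ?leq_addr // (act_sum HV) (lin_sum (pl n)).
  rewrite (@sum_single _ (fun i => p n (mode om 1 (p i x))) _ n); last 2 first.
  - by lia.
  - move=> i ni; rewrite (weightP (pA i x)) (linZ (pl n)) (pp _ i) //.
    by rewrite eq_sym (negPf ni) scaler0.
  by rewrite (weightP (pA n x)) (linZ (pl n)) (pp _ n) // eqxx.
have := pL v; rewrite (weightP kv) (linZ (pl n)) => /eqP.
rewrite -subr_eq0 -scalerBl -rmorphB scaler_eq0 intr_eq0 => /orP[/eqP|/eqP//].
by lia.
Qed.

Definition homogeneous_action (M : vmodule V) (A : nat -> set M) : Prop :=
  forall (k m : int) (n : nat) (v : V) (x : M),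
    weight_space k v -> A n x ->
    extend_by_zero A (n%:Z + k - m - 1) (act v m x).

Definition graded_module (M : vmodule V) (A : nat -> set M) (p : nat -> M -> M) :=
  grading A p /\ homogeneous_action A.

Lemma N_gradableP (M : vmodule V) :
  N_gradable M <-> exists A p, @graded_module M A p.
Proof.
split=> [[A [/direct_sum_grading[p gp] h]]|[A [p [gp h]]]]; first by exists A, p.
by exists A; split => //; apply/direct_sum_grading; exists p.
Qed.

Definition graded_sub (M : vmodule V) (p : nat -> M -> M) (K : set M) : Prop :=
  is_submodule K /\ (forall n x, K x -> K (p n x)).

Section OneModule.
Variables (M : vmodule V) (A : nat -> set M) (p : nat -> M -> M).
Hypothesis gM : graded_module A p.
Local Notation HM := (vmodule_axioms M).
Implicit Types x y : M.

Lemma grading_subspace n : is_subspace (A n). Proof. by case: gM => -[]. Qed.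
Lemma pr_linear n : linear (p n). Proof. by case: gM => -[]. Qed.
Lemma pr_in n x : A n (p n x). Proof. by case: gM => -[]. Qed.
Lemma pr_id m n x : A n x -> p m x = if m == n then x else 0.
Proof. by case: gM => -[_ _ _ h _] _; apply: h. Qed.
Lemma pr_same n x : A n x -> p n x = x.
Proof. by move=> /(pr_id n) ->; rewrite eqxx. Qed.
Lemma pr_sum x : exists N, forall B, (N <= B)%N -> x = \sum_(n < B) p n x.
Proof. by case: gM => -[_ _ _ _ h] _; apply: h. Qed.

Lemma pr_ext x y : (forall n, p n x = p n y) -> x = y.
Proof.
move=> e; have [N hN] := pr_sum x; have [N' hN'] := pr_sum y.
rewrite (hN (N + N')%N) ?leq_addr // (hN' (N + N')%N) ?leq_addl //.
by apply: eq_bigr.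
Qed.

Lemma pr_nz x : x != 0 -> exists n, p n x != 0.
Proof.
move=> x0; apply/not_existsP => h; move/eqP: x0; apply; apply: pr_ext => n.
by rewrite (lin0 (pr_linear n)); apply/eqP/negPn/negP/h.
Qed.

Lemma act_homogeneous k m (n n' : nat) v x : weight_space k v -> A n x ->
  n'%:Z = n%:Z + k - m - 1 -> A n' (act v m x).
Proof. by case: gM => _ h kv Ax e; have := h k m n v x kv Ax; rewrite -e. Qed.

Lemma act_negative k m (n : nat) v x : weight_space k v -> A n x ->
  n%:Z + k - m - 1 < 0 -> act v m x = 0.
Proof. by case: gM => _ h kv Ax; have := h k m n v x kv Ax; case: (_ - 1). Qed.

Lemma pr_act_homogeneous k m (n n' : nat) v x : weight_space k v -> A n x ->
  p n' (act v m x) = if n'%:Z == n%:Z + k - m - 1 then act v m x else 0.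
Proof.
move=> kv Ax; case: eqP => [e|ne]; first by rewrite (pr_same (act_homogeneous kv Ax e)).
have [d0|d0] := ltP (n%:Z + k - m - 1) 0.
  by rewrite (act_negative kv Ax d0) (lin0 (pr_linear _)).
have e : (absz (n%:Z + k - m - 1)%R)%:Z = n%:Z + k - m - 1 by lia.
rewrite (pr_id n' (act_homogeneous kv Ax e)) ifF //; apply/eqP => en; apply: ne.
by rewrite en.
Qed.

Lemma pr_act k m (n n' : nat) v x : weight_space k v ->
  n'%:Z = n%:Z + k - m - 1 -> p n' (act v m x) = act v m (p n x).
Proof.
move=> kv e; have [N hN] := pr_sum x.
rewrite {1}(hN (N + n.+1)%N) ?leq_addr // (act_sum HM) (lin_sum (pr_linear n')).
rewrite (@sum_single _ (fun i => p n' (act v m (p i x))) _ n); last 2 first.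
- by lia.
- move=> i /eqP ni; rewrite (pr_act_homogeneous _ _ kv (pr_in i x)) ifF //.
  by apply/eqP; lia.
by rewrite (pr_act_homogeneous _ _ kv (pr_in n x)) e eqxx.
Qed.

Definition cyclic x : set M := [set y |
  forall S, is_subspace S -> (forall v n, S (act v n x)) -> S y].

Lemma cyclic_subspace x : is_subspace (cyclic x).
Proof.
by split=> [S Ss _|c y z hy hz S Ss hS]; [exact: subspace0 Ss|apply: Ss.2;
  [apply: hy|apply: hz]].
Qed.

Lemma cyclic_act x v n : cyclic x (act v n x).
Proof. by move=> S _; apply. Qed.

Lemma cyclic_self x : cyclic x x.
Proof. by have := @cyclic_act x one (- 1); rewrite (act_one HM). Qed.

(** Products of two modes reduce to single modes, by induction on how far [n] lies below the
    truncation bound of [v] on [x]. *)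
Lemma cyclic_act2 x u v m n : cyclic x (act u m (act v n x)).
Proof.
have [N hN] := act_trunc HM u x; have [N' hN'] := act_trunc HM v x.
have Cs := cyclic_subspace x.
suff h d : forall m n : int, N'%:Z - d%:Z <= n -> cyclic x (act u m (act v n x)).
  by apply: (h (absz (N'%:Z - n)%R)); lia.
elim/ltn_ind: d => d IH {}m {}n hn.
(* Since [N] bounds the modes of [u] on [x], these parameters kill the terms where [u] acts first.
   The leading term is then u_m v_n x, and the others involve higher modes of [v]. *)
have [B0 hB] := jacobi_sum HV HM u v x (m - N%:Z) N%:Z n.
have := hB B0.+1 (leqnSn B0).
set LHS := \sum_(i < _) _ => e.
have LC : cyclic x LHS by apply: (subspace_sum_ord Cs) => i; apply: (subspaceZ Cs);
  apply: cyclic_act.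
move: e LC => ->; rewrite big_ord_recl => LC.
have term0 i : jacobi_term (@act _ _ M) u v x (m - N%:Z) N%:Z n i
  = ((- 1) ^+ i * gbinom C (m - N%:Z) i) *: act u (m - i%:Z) (act v (n + i%:Z) x).
  rewrite /jacobi_term [act u (_ + i%:Z) x]hN; last by lia.
  by rewrite (act0 HM) scaler0 subr0; congr (_ *: act _ _ _); lia.
have rest : cyclic x (\sum_(i < B0) jacobi_term (@act _ _ M) u v x (m - N%:Z) N%:Z n
  (lift ord0 i)).
  apply: (subspace_sum_ord Cs) => i; rewrite lift0 term0; apply: (subspaceZ Cs).
  have [nN|nN] := leP N'%:Z (n + i.+1%:Z).
    by rewrite hN' // (act0 HM); apply: subspace0 Cs.
  by apply: (IH (absz (N'%:Z - (n + i.+1%:Z))%R)); lia.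
have := subspaceB Cs LC rest; rewrite addrK term0 gbinom0 expr0 mulr1 scale1r.
by rewrite subr0 addr0.
Qed.

Lemma cyclic_submodule x : is_submodule (cyclic x).
Proof.
split; first exact: cyclic_subspace.
move=> u m y cy; apply: (cy (fun y => cyclic x (act u m y))).
  split; first by rewrite (act0 HM); apply: subspace0 (cyclic_subspace x).
  by move=> c z z' hz hz'; rewrite (act_linr HM); apply: (cyclic_subspace x).2.
by move=> v n; apply: cyclic_act2.
Qed.

Lemma cyclic_min x L : is_submodule L -> L x -> cyclic x `<=` L.
Proof. by move=> [Ls La] Lx y; apply => // v n; apply: La. Qed.

Lemma cyclic_graded n x : A n x -> graded_sub p (cyclic x).
Proof.
move=> Ax; split; first exact: cyclic_submodule.
have Cs := cyclic_subspace x.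
move=> m y cy; apply: (cy (fun y => cyclic x (p m y))).
  split; first by rewrite (lin0 (pr_linear m)); apply: subspace0 Cs.
  by move=> c z z' hz hz'; rewrite (pr_linear m); apply: Cs.2.
move=> v l; have [N [f [fw ->]]] := homogeneous_sum v.
rewrite (actl_sum HM) (lin_sum (pr_linear m)); apply: (subspace_sum_ord Cs) => i.
rewrite (pr_act_homogeneous _ _ (fw i) Ax); case: ifP => _; last exact: subspace0 Cs.
exact: cyclic_act.
Qed.

(* A vector of [L] with top component [z] is sent by a suitable mode to a
   nonzero vector of the lowest degree [d] of [P], which is homogeneous. *)
Lemma graded_simple_simple (P : set M) :
  graded_sub p P ->
  (forall L : set M, graded_sub p L -> L `<=` P -> (exists2 x, L x & x != 0) -> P
    `<=` L) ->
  forall L : set M, is_submodule L -> L `<=` P -> (exists2 x, L x & x != 0) -> P `<=` L.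
Proof.
move=> gP Pmin L Lsub LP [z Lz z0].
have Pgen n x : A n x -> P x -> x != 0 -> P `<=` cyclic x.
  move=> Ax Px x0; apply: Pmin; first exact: cyclic_graded Ax.
    exact: cyclic_min gP.1 Px.
  by exists x => //; apply: cyclic_self.
have exP : exists n, `[< exists x, [/\ P x, A n x & x != 0] >].
  have [n pz0] := pr_nz z0; exists n; apply/asboolP; exists (p n z).
  by split => //; [apply: gP.2; apply: LP|apply: pr_in].
case: (ex_minnP exP) => d /asboolP[e [Pe Ae e0]] dmin.
have low n x : P x -> (n < d)%N -> p n x = 0.
  move=> Px nd; apply/eqP/negPn/negP => px0.
  have : (d <= n)%N; last by lia.
  by apply: dmin; apply/asboolP; exists (p n x); split => //;
    [apply: gP.2|apply: pr_in].
have [N hN] := pr_sum z.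
have exD : exists n, p n z != 0 by apply: pr_nz.
have boundD n : p n z != 0 -> (n <= N)%N.
  move=> pz; rewrite leqNgt; apply/negP => Nn; move/eqP: pz; apply.
  rewrite (hN N) // (lin_sum (pr_linear n)) big1 // => -[i /= iN] _.
  by rewrite (pr_id _ (pr_in i z)); case: eqP => // ?; lia.
case: (ex_maxnP exD boundD) => D pD Dmax.
have PD : P (p D z) by apply: gP.2; apply: LP.
have [k [v [n [kv nz]]]] : exists (k : nat) v n, weight_space k%:Z v /\ p d (act v n
  (p D z)) != 0.
  apply: contrapT => hno.
  have : [set y | p d y = 0] e; last by rewrite /= (pr_same Ae); apply/eqP.
  apply: (Pgen D (p D z) (pr_in D z) PD pD e Pe).
    split; first exact: lin0 (pr_linear d).
    by move=> c x y /= hx hy; rewrite (pr_linear d) hx hy scaler0 addr0.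
  move=> v n /=; have [N' [f [fw ->]]] := homogeneous_sum v.
  rewrite (actl_sum HM) (lin_sum (pr_linear d)) big1 // => i _.
  by apply/eqP/negPn/negP => h; apply: hno; exists i, (f i), n.
have [dE|ne] := eqVneq d%:Z (D%:Z + k%:Z - n - 1); last first.
  by move: nz; rewrite (pr_act_homogeneous _ _ kv (pr_in D z)) (negPf ne) eqxx.
have Lvz : L (act v n z) by apply: Lsub.2.
(* This mode shifts degrees by d - D, so components of [z] below degree [D] would land below [d],
   where [P] is zero. *)
have Avz : A d (act v n z).
  have -> : act v n z = p d (act v n z); last exact: pr_in.
  apply: pr_ext => m; rewrite (pr_id _ (pr_in d _)); case: eqP => [->//|md].
  have [md'|dm] := ltnP m d; first by apply: low => //; apply: LP.
  have e' : m%:Z = (D + (m - d))%N%:Z + k%:Z - n - 1 by lia.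
  rewrite (pr_act _ kv e'); apply/eqP;
    rewrite (_ : p (D + (m - d)) z = 0) ?(act0 HM) //.
  by apply/eqP/negPn/negP => /Dmax; lia.
have vz0 : act v n z != 0.
  by apply: contra nz => /eqP h;
    rewrite -(pr_act _ kv dE) h (lin0 (pr_linear d)) (lin0 (pr_linear d)).
by apply: subset_trans (cyclic_min Lsub Lvz); apply: Pgen Avz (LP _ Lvz) vz0.
Qed.

End OneModule.
End GradedModules.

(** * Detection of vectors by copies of V *)

Section Detection.
Variables (R : realType) (V : voa R).
Hypothesis cft : cft_type V.
Local Notation C := R[i].
Local Notation HV := (voa_jacobi V).
Local Notation one := (vacuum V).
Local Notation om := (conformal V).
Implicit Types (u v w : V) (l k : int).

Lemma graded_quotient (M : vmodule V) A p (K : set M) :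
  graded_module A p -> graded_sub p K ->
  exists (Q : vmodule V) B q (f : M -> Q),
    [/\ @graded_module R V Q B q, module_hom f, forall n x, f (p n x) = q n (f x),
        forall y, exists x, f x = y & forall x, f x = 0 <-> K x].
Proof.
move=> gM [Ksub Kp]; have Ks := Ksub.1.
have [Q [f [[fl fa] fs fk]]] := quotient_module Ksub.
pose r y := sval (cid (fs y)); have rK y : f (r y) = y by rewrite /r; case: cid.
pose q n y := f (p n (r y)).
have fq n x : f (p n x) = q n (f x).
  apply/eqP; rewrite -subr_eq0 -(linB fl) -(linB (pr_linear gM n)); apply/eqP/fk/Kp/fk.
  by rewrite (linB fl) rK subrr.
have fsur (P : Q -> Prop) : (forall x, P (f x)) -> forall y, P y.
  by move=> h y; rewrite -(rK y).
have qin n x : A n x -> q n (f x) = f x by move=> Ax; rewrite -fq (pr_same gM Ax).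
exists Q, (fun n => f @` A n), q, f; split => //; split; first split.
- move=> n; split; first by exists 0;
  [apply: subspace0 (grading_subspace gM n)|apply: lin0 fl].
  move=> c _ _ [x Ax <-] [y Ay <-]; exists (c *: x + y); last exact: fl.
  exact: (grading_subspace gM n).2.
- move=> n c; elim/fsur => x; elim/fsur => y.
  by rewrite -fl -!fq (pr_linear gM) fl.
- by move=> n; elim/fsur => x; exists (p n x); [exact: pr_in gM n x|].
- move=> m n _ [x Ax <-]; rewrite -fq (pr_id gM m Ax); case: eqP => // _.
  exact: lin0 fl.
- elim/fsur => x; have [N hN] := pr_sum gM x; exists N => B NB.
  by rewrite {1}(hN B NB) (lin_sum fl); apply: eq_bigr => n _.
move=> k m n v _ kv [x Ax <-]; rewrite -fa.
have := (gM.2 k m n v x kv Ax); case: (_ - 1) => d /=; first by move=> Ad;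
  exists (act v m x).
by move=> ->; rewrite (lin0 fl).
Qed.

Lemma graded_submodule (M : vmodule V) A p (P : set M) :
  graded_module A p -> graded_sub p P ->
  exists (S : vmodule V) B q (f : S -> M),
    [/\ @graded_module R V S B q, module_hom f, injective f
      & forall x, P x <-> exists y, f y = x].
Proof.
move=> gM [Psub Pp]; have [S [f [[fl fa] fi fP]]] := sub_module Psub.
have Pf y : P (f y) by apply/fP; exists y.
pose q n y := sval (cid ((fP _).1 (Pp n _ (Pf y)))).
have fq n y : f (q n y) = p n (f y) by rewrite /q; case: cid.
exists S, (fun n y => A n (f y)), q, f; split => //; split; first split.
- move=> n; split; first by rewrite (lin0 fl); apply: subspace0 (grading_subspace gM n).
  by move=> c x y hx hy; rewrite fl; apply: (grading_subspace gM n).2.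
- by move=> n c x y; apply: fi; rewrite fl !fq fl (pr_linear gM).
- by move=> n x; rewrite fq; apply: pr_in gM n _.
- move=> m n x Ax; apply: fi; rewrite fq (pr_id gM m Ax).
  by case: ifP => // _; rewrite (lin0 fl).
- move=> x; have [N hN] := pr_sum gM (f x); exists N => B NB.
  by apply: fi; rewrite {1}(hN B NB) (lin_sum fl); apply: eq_bigr => n _.
move=> k m n v x kv Ax; have := (gM.2 k m n v _ kv Ax).
case: (_ - 1) => d /=; first by rewrite fa.
by move=> e; apply: fi; rewrite fa (lin0 fl).
Qed.

(** Zorn's lemma for the graded submodules that miss some vector of [s]. As [s] is finite, a chain
    whose union contains [s] already has a member containing [s]. *)
Lemma maximal_graded_sub (M : vmodule V) A p (s : seq M) :
  @graded_module R V M A p -> (exists2 x, x \in s & x != 0) ->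
  exists K : set M, [/\ graded_sub p K, ~ (forall x, x \in s -> K x)
    & forall L : set M, graded_sub p L -> K `<=` L -> ~ L `<=` K ->
        forall x, x \in s -> L x].
Proof.
move=> gM [x0 x0s x00]; have HM := vmodule_axioms M.
pose P (K : set M) := K = set0 \/ (graded_sub p K /\ ~ (forall x, x \in s -> K x)).
have P0 : P [set 0].
  right; split; last by move=> /(_ _ x0s) /= e; rewrite e eqxx in x00.
  split; last by move=> n x /= ->; rewrite (lin0 (pr_linear gM n)).
  split; last by move=> v n x /= ->; rewrite (act0 HM).
  by split=> //= c x y -> ->; rewrite scaler0 addr0.
have [F FP Ftot|K [PK Kmax]] := @Zorn_bigcup M P.
  have [[K1 [FK1 gK1]]|none] := pselect (exists K, F K /\ graded_sub p K); last first.
    left; rewrite predeqE => x; split => // -[K FK Kx].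
    by have [K0|[gK _]] := FP K FK; [rewrite K0 in Kx|case: none; exists K].
  have gF K x : F K -> K x -> graded_sub p K.
    by move=> FK Kx; have [K0|[]//] := FP K FK; rewrite K0 in Kx.
  right; split.
    split; last first.
      by move=> n x [K FK Kx]; exists K => //; apply: (gF K x FK Kx).2.
    split; last by move=> v n x [K FK Kx]; exists K => //; apply: (gF K x FK Kx).1.2.
    split; first by exists K1 => //; apply: subspace0 gK1.1.1.
    move=> c x y [K FK Kx] [K' FK' Ky].
    have [KK|KK] := Ftot _ _ FK FK'.
      by exists K' => //; apply: (gF _ _ FK' Ky).1.1.2 => //; apply: KK.
    by exists K => //; apply: (gF _ _ FK Kx).1.1.2 => //; apply: KK.
  move=> hall; have [K [FK Ks]] : exists K, F K /\ forall x, x \in s -> K x.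
    elim: s {x0s FP P P0 gF} hall => [|y s IH] hall; first by exists K1.
    have [K2 [FK2 h2]] := IH (fun x xs => hall x (@mem_behead _ (y :: s) x xs)).
    have [K3 FK3 h3] := hall y (mem_head y s).
    have [KK|KK] := Ftot _ _ FK2 FK3.
      by exists K3; split => // x; rewrite inE => /predU1P[->//|/h2/KK].
    by exists K2; split => // x; rewrite inE => /predU1P[->|/h2//]; apply: KK.
  by have [K0|[_]] := FP K FK; [have := Ks _ x0s; rewrite K0|apply].
have gK : graded_sub p K /\ ~ (forall x, x \in s -> K x).
  case: PK => // K0; case: (Kmax [set 0]) => //.
  by rewrite K0; split => // /(_ 0); apply.
exists K; split; [exact: gK.1|exact: gK.2|].
move=> L gL KL LK; apply: contrapT => nL.
by apply: (Kmax L); [split|right].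
Qed.

Hypothesis hol : holomorphic V.

Definition vhom (M : vmodule V) (g : V -> M) : Prop :=
  [/\ linear g, forall u n w, g (mode u n w) = act u n (g w) & injective g].

(** A minimal graded submodule is simple even among ungraded submodules, so holomorphy identifies it
    with [V]. *)
Lemma simple_graded_sub (M : vmodule V) A p (P : set M) :
  @graded_module R V M A p -> graded_sub p P -> (exists2 x, P x & x != 0) ->
  (forall L : set M, graded_sub p L -> L `<=` P -> (exists2 x, L x & x != 0) -> P
    `<=` L) ->
  exists g : V -> M, vhom g /\ forall x, P x <-> exists w, g w = x.
Proof.
move=> gM gP [x0 Px0 x00] Pmin.
have Psimple := graded_simple_simple cft gM gP Pmin.
have [S [B [q [f [gS [fl fa] fi fP]]]]] := graded_submodule gM gP.
have Ssimple : simple_module S.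
  split; first by move/fP: (Px0) => [y fy]; exists y; apply: contra x00 => /eqP y0;
    rewrite -fy y0 (lin0 fl).
  move=> L [Ls La]; have [[y Ly y0]|none] := pselect (exists2 y, L y & y != 0);
    last first.
    left; rewrite predeqE => y; split => [Ly|->]; last exact: subspace0 Ls.
    by apply: contrapT => /eqP y0; apply: none; exists y.
  right; rewrite predeqE => z; split => // _.
  have [z' Lz' /fi <- //] : (f @` L) (f z).
  apply: (Psimple (f @` L)).
  - split; last by move=> v n _ [x Lx <-]; exists (act v n x) => //; apply: La.
    split; first by exists 0; [exact: subspace0 Ls|exact: lin0 fl].
    by move=> c _ _ [x Lx <-] [x' Lx' <-]; exists (c *: x + x');
      [apply: Ls.2|rewrite fl].
  - by move=> _ [x _ <-]; apply/fP; exists x.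
  - exists (f y); first by exists y.
    by apply: contra y0 => /eqP fy0; apply/eqP/fi; rewrite fy0 (lin0 fl).
  - by apply/fP; exists z.
have SN : N_gradable S by apply/N_gradableP; exists B, q.
have [_ _ /(_ S Ssimple SN)[h [[hl ha] hb]]] := hol.
exists (fun v => f (h v)); split.
  split.
  - by move=> c u v; rewrite hl fl.
  - by move=> u n w; rewrite -fa -ha.
  - by move=> u v /fi; apply: (bij_inj hb).
move=> x; split=> [/fP[y <-]|[w <-]]; last by apply/fP; exists (h w).
by case: hb => h' _ hK; exists (h' y); rewrite hK.
Qed.

(** Divide by a graded submodule maximal among those not containing all of [s]. A nonzero graded
    submodule of the quotient pulls back to a strictly larger one, hence contains the images of [s].
    So these images generate a minimal graded submodule, a copy of [V]. *)
Lemma detection (M : vmodule V) A p (s : seq M) :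
  @graded_module R V M A p -> (forall x, x \in s -> exists n, A n x) ->
  (exists2 x, x \in s & x != 0) ->
  exists (Q : vmodule V) B q (f : M -> Q) (g : V -> Q),
    [/\ @graded_module R V Q B q,
        [/\ module_hom f, forall n x, f (p n x) = q n (f x) & forall y, exists x, f x
          = y],
        vhom g, graded_sub q (range g)
      & (forall x, x \in s -> exists w, f x = g w) /\ (exists2 x, x \in s & f x != 0)].
Proof.
move=> gM sA snz; have [K [gK nK Kmax]] := maximal_graded_sub gM snz.
have [Q [B [q [f [gQ [fl fa] fq fs fk]]]]] := graded_quotient gM gK.
pose P : set Q := [set y | forall L : set Q, graded_sub q L -> (forall x, x \in s ->
  L (f x)) -> L y].
have Ps : is_subspace P.
  split=> [L gL _|c x y Px Py L gL Ls]; first exact: subspace0 gL.1.1.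
  by apply: gL.1.1.2; [apply: Px|apply: Py].
have gP : graded_sub q P.
  split; last by move=> n x Px L gL Ls; apply: gL.2; apply: Px.
  by split => // v n x Px L gL Ls; apply: gL.1.2; apply: Px.
have [x1 x1s Kx1] : exists2 x, x \in s & ~ K x.
  apply: contrapT => h; apply: nK => x xs; apply: contrapT => Kx.
  by apply: h; exists x.
have fx1 : f x1 != 0 by apply/eqP => /fk.
have Pfs x : x \in s -> P (f x) by move=> xs L gL; apply.
have [||g [gh gr]] := simple_graded_sub gQ gP.
- by exists (f x1) => //; apply: Pfs.
- move=> L gL LP [y Ly y0]; suff Ls x : x \in s -> L (f x) by move=> z; apply.
  move: x; apply: (Kmax (f @^-1` L)).
  + split; last by move=> n x /= Lx; rewrite fq; apply: gL.2.
    split; last by move=> v n x /= Lx; rewrite fa; apply: gL.1.2.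
    split; first by rewrite /= (lin0 fl); apply: subspace0 gL.1.1.
    by move=> c x x' /= h h'; rewrite fl; apply: gL.1.1.2.
  + by move=> x /fk /= ->; apply: subspace0 gL.1.1.
  + have [x fx] := fs y; move=> /(_ x) /=; rewrite fx => /(_ Ly) /fk.
    by rewrite fx => e; rewrite e eqxx in y0.
have Pg : range g = P.
  by rewrite predeqE => y; split=> [[w _ <-]|/gr[w <-]]; [apply/gr; exists w|exists w].
exists Q, B, q, f, g; split => //; first by rewrite Pg.
split; last by exists x1.
by move=> x /Pfs/gr[w <-]; exists w.
Qed.

Lemma vacuum_neq0 : one != 0.
Proof.
have [[[x x0] _] _ _] := hol; apply: contra x0 => /eqP o0.
by rewrite -(mode_vacuumN1 (x : V)) o0 (act0 HV).
Qed.

Lemma translation_kernel v : mode om 0 v = 0 -> exists c : C, v = c *: one.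
Proof.
move=> Dv; have : weight_space 0 v.
  rewrite /weight_space /Lop /= scale0r.
  exact: (@vacuum_like R V (adjoint_module V) om v 1 Dv).
by have [_ e] := cft; rewrite e.
Qed.

Lemma translation_vacuum : mode om 0 one = 0.
Proof. exact: (mode_vacuum om 0). Qed.

Lemma vhom_translation (M : vmodule V) (g : V -> M) : vhom g -> act om 0 (g one) = 0.
Proof. by move=> [gl ga _]; rewrite -ga translation_vacuum (lin0 gl). Qed.

Lemma pr_translation (M : vmodule V) A p n x : @graded_module R V M A p ->
  p n.+1 (act om 0 x) = act om 0 (p n x).
Proof. by move=> gM; apply: (pr_act gM _ (weight_conformal V)); lia. Qed.

(** A component of [g one] lies in the image of [g] and is killed by L(-1), so it is a multiple of
    [g one]. Thus [g one] has a single degree [d], and [g] sends weight [k] to degree [d + k]. *)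
Lemma vhom_degree (M : vmodule V) A p (g : V -> M) :
  @graded_module R V M A p -> vhom g -> graded_sub p (range g) ->
  exists d, A d (g one) /\ forall n z w, A n z -> z != 0 -> z = g w ->
    exists2 k : nat, (d + k = n)%N & weight_space k%:Z w.
Proof.
move=> gM gh gr; have [gl ga gi] := gh.
have g1 : g one != 0.
  by apply: contra vacuum_neq0 => /eqP e; apply/eqP/gi; rewrite e (lin0 gl).
have [d pd] := pr_nz gM g1; exists d.
have Ad : A d (g one).
  have [w _ gw] : range g (p d (g one)) by apply: gr.2; exists one.
  have [c wc] : exists c : C, w = c *: one.
    apply: translation_kernel; apply: gi; rewrite (lin0 gl) ga gw.
    by rewrite -(pr_translation _ _ gM) vhom_translation // (lin0 (pr_linear gM _)).
  have c0 : c != 0.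
    by apply: contra pd => /eqP c0; rewrite -gw wc c0 scale0r (lin0 gl).
  apply: (subspaceZ_inv (grading_subspace gM d) c0); rewrite -(linZ gl) -wc gw.
  exact: pr_in gM d _.
split => // n z w Az z0 zw.
have [pV [Vs Vl Vin Vp Vsum]] := weight_grading cft.
have gk (k : nat) v : weight_space k%:Z v -> A (d + k)%N (g v).
  move=> kv; rewrite -(mode_vacuumN1 v) ga.
  by apply: (act_homogeneous gM kv Ad); lia.
have [N hN] := Vsum w.
have dn : (d <= n)%N.
  rewrite leqNgt; apply/negP => nd; move/eqP: z0; apply.
  rewrite -(pr_same gM Az) zw (hN N) // (lin_sum gl) (lin_sum (pr_linear gM n)).
  rewrite big1 // => i _; rewrite (pr_id gM n (gk i _ (Vin i w))).
  by case: eqP => // ?; lia.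
exists (n - d)%N; first by rewrite subnKC.
suff -> : w = pV (n - d)%N w by apply: Vin.
apply: gi; rewrite -zw -(pr_same gM Az) {1}zw (hN (N + (n - d).+1)%N) ?leq_addr //.
rewrite (lin_sum gl) (lin_sum (pr_linear gM n)).
rewrite (@sum_single _ (fun i => p n (g (pV i w))) _ (n - d)%N); last 2 first.
- by lia.
- move=> i /eqP ni; rewrite (pr_id gM n (gk i _ (Vin i w))).
  by case: eqP => // ?; lia.
have Ag := gk _ _ (Vin (n - d)%N w); rewrite subnKC // in Ag.
by rewrite (pr_same gM Ag) -(hN (N + (n - d).+1)%N) ?leq_addr.
Qed.

End Detection.

(** * The lowest degree of a module *)

Section LowestDegree.
Variables (R : realType) (V : voa R).
Hypothesis cft : cft_type V.
Local Notation C := R[i].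
Local Notation HV := (voa_jacobi V).
Local Notation one := (vacuum V).
Local Notation om := (conformal V).
Implicit Types (u v w : V) (l k : int).

Lemma weight_subspace k : is_subspace (@weight_space R V k).
Proof.
split; first by rewrite /weight_space /Lop /= (act0 HV) scaler0.
move=> c x y hx hy; rewrite /weight_space /Lop /= (act_linr HV) (weightP hx) (weightP
  hy).
by rewrite scalerDr !scalerA mulrC.
Qed.

Lemma weight0E v : weight_space 0 v -> exists c : C, v = c *: one.
Proof. by have [_ e] := cft; rewrite e. Qed.

(** The last clause comes from invariance with a = v = w, u = 1 and m = 1, which reads -(w, w) = (1,
    phi(w)_1 w); positivity makes the left side nonzero. *)
Lemma unitary_conjugation : unitary V -> exists phi : V -> V,
  [/\ forall u n v, phi (mode u n v) = mode (phi u) n (phi v),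
      forall v, phi (phi v) = v, phi 0 = 0,
      forall w, weight_space 1 w -> weight_space 1 (phi w)
    & forall w, weight_space 1 w -> w != 0 -> mode (phi w) 1 w != 0].
Proof.
move=> [phi [form [[phil phiK phi1 phiom phim] [forml formC formp] inv]]].
have phi0 : phi 0 = 0 by have := phil (- 1) 0 0;
  rewrite scaler0 addr0 rmorphN1 scaleN1r addNr.
have form0 w : form 0 w = 0.
  by apply: (addrI (form 0 w)); rewrite -{1}[form 0 w]mul1r -forml scaler0 !addr0.
have formZ0 w : form w 0 = 0 by rewrite formC form0 conjC0.
exists phi; split => //.
  move=> w w1; rewrite /weight_space /Lop /= -phiom -phim.
  have -> : mode om 1 w = 1%:~R *: w by exact: weightP w1.
  by rewrite !scale1r.
move=> w w1 w0; apply/eqP => ww0.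
pose w_ (k : int) := if k == 1 then w else 0.
have Lw0 j k : k != 1 -> iter j (@Lop R V 1) (w_ k) = 0.
  move=> /negPf k1; elim: j => [|j IH] /=; first by rewrite /w_ k1.
  by rewrite IH /Lop (act0 HV).
have [c Lw] : exists c : C, Lop 1 w = c *: one.
  apply: weight0E; rewrite /Lop.
  by have := weight_mode (1 + 1) (@weight_conformal R V) w1.
have Lw2 j : iter j.+2 (@Lop R V 1) w = 0.
  elim: j => [|j IH]; last by rewrite iterS IH /Lop (act0 HV).
  rewrite /= Lw /Lop (actZ HV) (_ : mode om (1 + 1) one = 0) ?scaler0 //.
  exact: (mode_vacuum om 2).
have dec : decomposes (@weight_space R V) w w_.
  split.
  - by move=> k; rewrite /w_; case: eqP => [->//|_];
    apply: subspace0 (weight_subspace k).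
  - apply: (@sub_finite_set _ _ [set 1]) => //.
    by move=> k /=; rewrite /w_; case: (k =P 1) => // _; rewrite eqxx.
  - by rewrite (@fsum_supp1 _ _ (1 : int) w_) // => k /negPf k1; rewrite /w_ k1.
have := inv w w_ one w 1 dec.
rewrite (@fsum_supp1 _ _ 1) => [|k k1]; last first.
  by rewrite fsbig1 // => j _; rewrite Lw0 // (actl0 HV) form0 mulr0.
(* The term j = 1 contains the mode -2 of a multiple of the vacuum, and the later ones contain L(1)
   1; all are zero. *)
rewrite (@fsum_supp1 _ _ 0%N) => [|[|[|j]] // _]; last 2 first.
- rewrite /= /w_ eqxx Lw (actlZ HV) (act_one HV).
  by rewrite scaler0 form0 mulr0.
- by rewrite /w_ eqxx Lw2 (actl0 HV) form0 mulr0.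
rewrite ww0 formZ0 /= /w_ eqxx (_ : 2 * 1 - 0%:Z - 1 - 2 = - 1 :> int) //.
rewrite mode_vacuumN1 expr1z fact0 divr1 mulN1r => /eqP.
rewrite oppr_eq0 => /eqP e; by have := formp w w0; rewrite e ltxx.
Qed.

Hypotheses (uni : unitary V) (hol : holomorphic V).

Lemma Delta_coef_weight a k u (p : nat) : weight_space 1 a -> weight_space k u ->
  weight_space (k - p%:Z) (Delta_coef (@mode R V) a p u).
Proof.
move=> a1 ku; elim/ltn_ind: p => -[_|p IH]; first by rewrite subr0.
have n0 : p.+1%:R != 0 :> C by rewrite pnatr_eq0.
apply: (subspaceZ_inv (weight_subspace _) n0); rewrite Delta_coefS.
apply: (subspace_sum_ord (weight_subspace _)) => -[j /= jp].
apply: (subspaceZ (weight_subspace _)).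
have := weight_mode j.+1%:Z a1 (IH (p - j)%N _).
rewrite (_ : 1 + (k - (p - j)%N%:Z) - j.+1%:Z - 1 = k - p.+1%:Z); last by lia.
by apply; lia.
Qed.

(* Otherwise [h] would act by a nonzero scalar on the deformation of [V] by
   [phi h], which has a simple graded quotient not isomorphic to [V]. *)
Lemma central_weight1_eq0 h : weight_space 1 h -> (forall v, mode h 0 v = 0) -> h = 0.
Proof.
move=> h1 h0; apply/eqP/negPn/negP => hn0.
have [phi [phim phiK phi0 phi1 phin0]] := unitary_conjugation uni.
pose a := phi h; have a1 : weight_space 1 a := phi1 h h1.
have a0 v : mode a 0 v = 0 by rewrite -[v]phiK -phim h0 phi0.
have a_one (j : nat) : mode a j%:Z one = 0 := mode_vacuum a j.
pose E := Delta_coef (@mode R V) a.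
have Eneg (k : nat) u p : weight_space k%:Z u -> (k < p)%N -> E p u = 0.
  move=> ku kp; apply: contrapT => /eqP /(weight_ge0 cft (Delta_coef_weight p a1 ku)).
  by lia.
have Delta_nil u : exists P : nat, forall p, (P <= p)%N -> E p u = 0.
  have [N [f [fw ->]]] := homogeneous_sum cft u; exists N => p Np.
  rewrite /E (lin_sum (Delta_coef_linear HV a p)) big1 // => -[i /= iN] _.
  by apply: (Eneg i) => //; lia.
pose M := VModule (deformed_module HV a0 a_one Delta_nil HV).
have [c hc] : exists c : C, mode a 1 h = c *: one.
  by apply: weight0E; have := weight_mode 1 a1 h1.
have c0 : c != 0.
  by have := phin0 h h1 hn0; rewrite -/a hc; apply: contra => /eqP->; rewrite scale0r.
(* As [h] has weight one, only p = 0 and p = 1 contribute to its twisted zero mode: the former is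
   h_0 = 0, the latter the mode -1 of a_1 h = c 1. *)
have hM (y : M) : act h 0 y = c *: y.
  rewrite /= (deformed_actE HV _ _ (P := 2)) => [|p p2]; last exact: (Eneg 1%N).
  rewrite big_ord_recl big_ord1 /= subr0 h0 add0r.
  have -> : Delta_coef (@mode R V) a 1 h = mode a 1 h.
    have := Delta_coefS (@mode R V) a 0 h; rewrite scale1r big_ord1 expr0 scale1r.
    by move=> ->.
  by rewrite hc (actlZ HV) (act_one HV).
have [pV gV] := weight_grading cft.
(* The weight lost in [E p v] is offset by the shift of the mode index, so the twisted module keeps
   the grading of [V]. *)
have gM : @graded_module R V M (fun n : nat => @weight_space R V n%:Z) pV.
  split=> // k m n v x kv nx.
  have W : weight_space (n%:Z + k - m - 1) (act v m (x : M)).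
    have [P hP] := Delta_nil v; rewrite /= (deformed_actE HV _ _ hP).
    apply: (subspace_sum_ord (weight_subspace _)) => p.
    have := weight_mode (m - p%:Z) (Delta_coef_weight p a1 kv) nx.
    by congr (weight_space _ _); lia.
  move: W; case: (_ - 1) => d // W /=; apply: contrapT => /eqP.
  by move=> /(weight_ge0 cft W).
have [||Q [B [q [f [g [gQ [[fl fa] _ _] [gl ga _] _ [hs [x]]]]]]]] :=
    detection cft hol (s := [:: (one : M)]) gM.
- by move=> x; rewrite inE => /eqP->; exists 0%N; apply: weight_vacuum.
- by exists one; [rewrite inE|exact: vacuum_neq0 hol].
rewrite inE => /eqP -> /eqP; apply.
have [w fw] := hs one (mem_head _ _).
(* On [f one] the zero mode of [h] is the scalar [c], as in the twisted module, and also zero, as in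
   the copy of [V]. *)
have : c *: f one = 0 by rewrite -(linZ fl) -hM fa fw -ga h0 (lin0 gl).
by move/eqP; rewrite scaler_eq0 (negPf c0) => /eqP.
Qed.

(** Coefficientwise form of Y(w, z) 1 = e^(z L(-1)) w. *)
Lemma mode_vacuum_iter w (i : nat) :
  i`!%:R *: mode w (- 1 - i%:Z) one = iter i (mode om 0) w.
Proof.
elim: i => [|i IH]; first by rewrite fact0 scale1r subr0 mode_vacuumN1.
have e := @translation_comm R V (adjoint_module V) w (- 1 - i%:Z) one.
rewrite /= in e; rewrite iterS -IH (actZ HV) e translation_vacuum (act0 HV) sub0r.
rewrite -scaleNr -rmorphN scalerA factS natrM mulrC [i.+1%:R]pmulrn /=.
by congr ((_ * _%:~R) *: mode _ _ _); lia.
Qed.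

(* [e^(- z L(-1)) Y(v, z) x] has no residue after differentiation in [z], while
   its derivative is [- g (Y(h, - z) v)] by skew symmetry. *)
Lemma zero_mode_translation (M : vmodule V) (g : V -> M) (x : M) h v :
  vhom g -> g h = act om 0 x -> mode h 0 v = 0.
Proof.
move=> [gl ga gi] ghx; have HM := vmodule_axioms M.
pose D := act om 0 : M -> M.
have Dl : linear D := act_linr HM om 0.
have Dil i : linear (iter i D).
  by elim: i => [|i IH] c y z //=; rewrite IH Dl.
have [N1 hN1] := act_trunc HV v h; have [N2 hN2] := act_trunc HM v x.
pose B := (N1 + N2)%N.
(* The commutator of v_(-1) and h_0 on the vacuum is skew symmetry: -h_0 v is the sum of the (-1)^i
   (v_i h)_(-1-i) 1. *)
have := commutator HV HV (u := v) (v := h) one (- 1) 0 (B := B.+1).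
rewrite (mode_vacuum h 0) (act0 HV) sub0r mode_vacuumN1 => e.
apply: gi; rewrite (lin0 gl) -[mode h 0 v]opprK e => [|i hi]; last first.
  by apply: hN1; lia.
rewrite (linN gl) (lin_sum gl).
(* Under [g] the summand of index i becomes (-1)^i / i! L(-1)^i v_i L(-1) x. Moving the last L(-1)
   to the left of v_i gives [T i] minus its predecessor, so the sum telescopes to a term beyond the
   truncation bound. *)
pose T i := ((- 1) ^+ i / i`!%:R) *: iter i.+1 D (act v i%:Z x).
have step (i : nat) :
  g (gbinom C (- 1) i *: mode (mode v i%:Z h) (- 1 + 0 - i%:Z) one)
  = T i - (if i is j.+1 then T j else 0) :> M.
  have i0 : i`!%:R != 0 :> C by rewrite pnatr_eq0 -lt0n fact_gt0.
  have gi' w : g (iter i (mode om 0) w) = iter i D (g w).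
    by elim: i {i0} => //= i <-; rewrite ga.
  rewrite addr0 -(gbinom_reflect C 0 i) gbinom0 mulr1 (linZ gl).
  have -> : mode (mode v i%:Z h) (- 1 - i%:Z) one = i`!%:R^-1 *: iter i (mode om 0)
    (mode v i%:Z h).
    by rewrite -mode_vacuum_iter scalerA mulVf // scale1r.
  rewrite (linZ gl) scalerA gi' ga ghx.
  have := translation_comm v i%:Z x; move/eqP; rewrite eq_sym subr_eq => /eqP ->.
  rewrite (linD (Dil i)) (linZ (Dil i)) scalerDr -iterSr; congr (_ + _).
  case: i {i0 gi'} => [|j]; first by rewrite scale0r scaler0 oppr0.
  have j0 : j`!%:R != 0 :> C by rewrite pnatr_eq0 -lt0n fact_gt0.
  have j1 : j.+1%:R != 0 :> C by rewrite pnatr_eq0.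
  rewrite /T -scaleNr scalerA factS natrM exprS mulN1r -pmulrn (_ : j.+1%:Z - 1 =
    j%:Z); last by lia.
  congr (_ *: _); move: (j.+1%:R) (j`!%:R) j0 j1 => b c c0 b0.
  by field; rewrite b0 c0.
rewrite (eq_bigr (fun i : 'I_B.+1 =>
  T i - (if nat_of_ord i is j.+1 then T j else 0))) => [|i _]; last first.
  exact: step.
have -> (k : nat) : \sum_(i < k.+1) (T i - (if nat_of_ord i is j.+1 then T j else 0))
  = T k.
  by elim: k => [|k IH];
    [rewrite big_ord1 subr0|rewrite big_ord_recr /= IH addrC subrK].
by rewrite /T hN2 ?(lin0 (Dil _)) ?scaler0 ?oppr0 //; lia.
Qed.

Lemma act_comm10 (M : vmodule V) u (x : M) :
  act u 1 (act om 0 x) = act om 0 (act u 1 x) + act u 0 x.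
Proof. by rewrite translation_comm scale1r subrK. Qed.

Lemma L0_translation (M : vmodule V) (x : M) :
  act om 1 (act om 0 x) = act om 0 (act om 1 x) + act om 0 x.
Proof.
rewrite (L0_comm _ _ (@weight_conformal R V)) (_ : 2 - 0 - 1 = 1 :> int) //.
by rewrite scale1r.
Qed.

(** In a copy of [V] that detects [x], degree 0 leaves only weight 0, on which L(0) is zero. *)
Lemma degree0_L0 (M : vmodule V) A p (x : M) (c : int) : @graded_module R V M A p ->
  A 0%N x -> act om 1 x = c%:~R *: x -> x != 0 -> c = 0.
Proof.
move=> gM A0x L0x x0.
have [||Q [B [q [f [g [gQ [[fl fa] fq _] gh gr [hs [y]]]]]]]] :=
    detection cft hol (s := [:: x]) gM.
- by move=> y; rewrite inE => /eqP->; exists 0%N.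
- by exists x; rewrite ?inE.
rewrite inE => /eqP -> fx0; have [w fw] := hs x (mem_head _ _).
have [d [_ /(_ 0%N (f x) w)]] := vhom_degree cft hol gQ gh gr.
have B0 : B 0%N (f x) by rewrite -(pr_same gM A0x) fq; apply: pr_in gQ _ _.
move=> /(_ B0 fx0 fw)[k dk kw]; have k0 : k = 0%N by lia.
have [gl ga _] := gh.
have := congr1 f L0x; rewrite fa (linZ fl) fw -ga (weightP kw) k0 scale0r (lin0 gl) -fw.
move=> /esym/eqP; rewrite scaler_eq0 (negPf fx0) orbF intr_eq0 => /eqP. by [].
Qed.

(** A nonzero L(-1) x would be detected as a vector [w] of a copy of [V]. Its degree 1 leaves the
    weights 0 and 1 for [w], and each is excluded. *)
Lemma degree0_vacuum_like (M : vmodule V) A p (x : M) : @graded_module R V M A p ->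
  A 0%N x -> (forall u, weight_space 1 u -> act u 0 x = 0) -> act om 0 x = 0.
Proof.
move=> gM A0x ux0; apply/eqP/negPn/negP => z0.
have HM := vmodule_axioms M.
have A1z : A 1%N (act om 0 x).
  by apply: (act_homogeneous gM (@weight_conformal R V) A0x).
have [||Q [B [q [f [g [gQ [[fl fa] fq _] gh gr [hs [y]]]]]]]] :=
    detection cft hol (s := [:: act om 0 x]) gM.
- by move=> y; rewrite inE => /eqP->; exists 1%N.
- by exists (act om 0 x); rewrite ?inE.
rewrite inE => /eqP -> fz0; have [w fw] := hs _ (mem_head _ _).
have gA n z : A n z -> B n (f z) by move=> An; rewrite -(pr_same gM An) fq;
  apply: pr_in gQ _ _.
have HQ := vmodule_axioms Q.
have [gl ga gi] := gh.
have [d [_ /(_ 1%N _ w (gA _ _ A1z) fz0 fw)[k dk kw]]] := vhom_degree cft hol gQ gh gr.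
have uz u : weight_space 1 u -> act u 1 (act om 0 x) = 0.
  move=> u1; rewrite act_comm10 ux0 // (act_negative gM u1 A0x) // (act0 HM) addr0 //.
case: k dk kw => [|[|k]] dk kw; last by lia.
  (* In weight 0, L(-1) kills L(0) f(x) + f(x), and so does L(0). Then L(0) f(x) is an eigenvector
     of eigenvalue -1 in degree 0, against [degree0_L0]. *)
  have [c wc] := weight0E kw.
  have L0z : act om 1 (act om 0 (f x)) = 0.
    by rewrite -fa fw -ga (weightP kw) scale0r (lin0 gl).
  pose x3 := act om 1 (f x).
  have B0x3 : B 0%N x3
    by apply: (act_homogeneous gQ (@weight_conformal R V) (gA _ _ A0x)).
  have Dx2 : act om 0 (x3 + f x) = 0 by rewrite (actD HQ) -L0_translation L0z.
  have L0x2 : act om 1 (x3 + f x) = 0 by exact: (@vacuum_like _ _ _ om _ 1 Dx2).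
  have L0x3 : act om 1 x3 = (- 1)%:~R *: x3.
    by apply/eqP; rewrite scaleN1r -subr_eq0 opprK -(actD HQ) L0x2.
  have x30 : x3 != 0.
    apply: contra fz0 => /eqP x30; rewrite fa.
    by move: Dx2; rewrite x30 add0r => ->.
  by have := degree0_L0 gQ B0x3 L0x3 x30.
(* In weight 1, [uz] makes phi(w)_1 w vanish, against unitarity. *)
have [phi [_ _ _ phi1 phin0]] := unitary_conjugation uni.
have w0 : w != 0 by apply: contra fz0 => /eqP w0; rewrite fw w0 (lin0 gl).
have := phin0 w kw w0; apply/negP; rewrite negbK; apply/eqP/gi.
by rewrite (lin0 gl) ga -fw -fa uz ?(lin0 fl) //; apply: phi1.
Qed.

(** The vectors given by [voa_finite_dim] may lie outside the weight space, hence the projection.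
    They are only asked to span. *)
Lemma weight1_basis : exists (d : nat) (e : 'I_d -> V), (forall i, weight_space 1 (e i))
  /\ forall u, weight_space 1 u -> exists c : 'I_d -> C, u = \sum_(i < d) c i *: e i.
Proof.
have [d [e he]] := @voa_finite_dim R V 1.
have [pV [_ pl pin pid _]] := weight_grading cft.
exists d, (fun i => pV 1%N (e i)); split; first by move=> i; apply: pin.
move=> u u1; have [c uc] := he u u1; exists c.
have := pid 1%N 1%N u u1; rewrite eqxx {1}uc (lin_sum (pl _)) => <-.
by apply: eq_bigr => i _; rewrite (linZ (pl _)).
Qed.

(** As V_1 is finite-dimensional, one copy of [V] can contain the images of all u_0 x, not all zero.
    These vanish after dividing by that copy, so L(-1) x maps to some [g h]. Then [h] is a nonzero
    vector of weight one with h_0 = 0, which [central_weight1_eq0] forbids. *)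
Lemma degree0_weight1 (M : vmodule V) A p (x : M) u : @graded_module R V M A p ->
  A 0%N x -> weight_space 1 u -> act u 0 x = 0.
Proof.
move=> gM A0x u1; apply/eqP/negPn/negP => ux0; have HM := vmodule_axioms M.
have [n [e [e1 espan]]] := weight1_basis.
have A0u v : weight_space 1 v -> A 0%N (act v 0 x).
  by move=> v1; apply: (act_homogeneous gM v1 A0x).
pose s := [seq act (e i) 0 x | i <- enum 'I_n].
have [||Q [B [q [f [g [gQ [[fl fa] fq _] gh gr [hs [y]]]]]]]] := detection cft hol (s
  := s) gM.
- by move=> y /mapP[i _ ->]; exists 0%N; apply: A0u.
- apply: contrapT => h; move/eqP: ux0; apply; have [c ->] := espan u u1.
  rewrite (actl_sum HM) big1 // => i _; rewrite (actlZ HM).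
  apply: contrapT => /eqP ex; apply: h; exists (act (e i) 0 x).
    by apply: map_f; rewrite mem_enum.
  by apply: contra ex => /eqP ->; rewrite scaler0.
move=> /mapP[i0 _ ->] fe0; have HQ := vmodule_axioms Q.
have gA m z : A m z -> B m (f z) by move=> An; rewrite -(pr_same gM An) fq;
  apply: pr_in gQ _ _.
have [gl ga gi] := gh.
have gsub : is_subspace (range g) := gr.1.1.
have fu v : weight_space 1 v -> range g (act v 0 (f x)).
  move=> v1; have [c ->] := espan v v1.
  rewrite (actl_sum HQ); apply: (subspace_sum_ord gsub) => i; rewrite (actlZ HQ).
  apply: (subspaceZ gsub); rewrite -fa.
  have [w ->] : exists w, f (act (e i) 0 x) = g w; last by exists w.
  by apply: hs; apply: map_f; rewrite mem_enum.
have [Q' [B' [q' [f' [gQ' [f'l f'a] f'q _ f'k]]]]] := graded_quotient gQ gr.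
have B'0 : B' 0%N (f' (f x)).
  by rewrite -(pr_same gQ (gA _ _ A0x)) f'q; apply: pr_in gQ' _ _.
have [h _ gh'] : range g (act om 0 (f x)).
  apply/f'k; rewrite f'a; apply: (degree0_vacuum_like gQ' B'0) => v v1.
  by rewrite -f'a; apply/f'k/fu.
(* The mode 1 of [e i0] kills degree 0, so commuting it past L(-1) leaves the nonzero detected
   vector; this shows that [h] is nonzero. *)
have e10 : act (e i0) 1 (g h) = f (act (e i0) 0 x).
  rewrite gh' act_comm10 fa (act_negative gQ (e1 i0) (gA _ _ A0x)) //.
  by rewrite (act0 HQ) add0r.
have [d [Bd gdeg]] := vhom_degree cft hol gQ gh gr.
have Bom : B 1%N (act om 0 (f x)).
  by apply: (act_homogeneous gQ (@weight_conformal R V) (gA _ _ A0x)).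
have d0 : d = 0%N.
  have [w fw] : exists w, f (act (e i0) 0 x) = g w.
    by apply: hs; apply: map_f; rewrite mem_enum.
  have [k dk _] := gdeg 0%N _ w (gA _ _ (A0u _ (e1 i0))) fe0 fw; lia.
have h0 : h != 0.
  by apply: contra fe0 => /eqP h0; rewrite -e10 h0 (lin0 gl) (act0 HQ).
have omx0 : act om 0 (f x) != 0.
  by rewrite -gh'; apply: contra h0 => /eqP e0; apply/eqP/gi; rewrite e0 (lin0 gl).
have h1 : weight_space 1 h.
  have [k dk kh] := gdeg 1%N _ h Bom omx0 (esym gh').
  by move: kh; rewrite (_ : k = 1%N) //; lia.
move/eqP: h0; apply; apply: central_weight1_eq0 => // v.
exact: (zero_mode_translation v gh gh').
Qed.

End LowestDegree.

(** * Generation by vacuum-like vectors *)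

Section Generation.
Variables (R : realType) (V : voa R).
Hypothesis cft : cft_type V.
Local Notation C := R[i].
Local Notation HV := (voa_jacobi V).
Local Notation one := (vacuum V).
Local Notation om := (conformal V).
Implicit Types (u v w : V) (l k : int).

Definition generated (M : vmodule V) (X : set M) : set M :=
  [set y | forall L : set M, is_submodule L -> X `<=` L -> L y].

Lemma generated_submodule (M : vmodule V) (X : set M) : is_submodule (generated X).
Proof.
split; last by move=> v n x gx L Ls XL; apply: Ls.2; apply: gx.
split; first by move=> L [Ls _] _; apply: subspace0 Ls.
by move=> c x y gx gy L Ls XL; apply: Ls.1.2; [apply: gx|apply: gy].
Qed.

Lemma generated_mem (M : vmodule V) (X : set M) : X `<=` generated X.
Proof. by move=> x Xx L _; apply. Qed.

Lemma generatedS (M : vmodule V) (X X' : set M) : X `<=` X' -> generated X `<=`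
  generated X'.
Proof. by move=> XX x gx L Ls XL; apply: gx => // y /XX/XL. Qed.

Section Graded.
Variables (M : vmodule V) (A : nat -> set M) (p : nat -> M -> M).
Hypothesis gM : graded_module A p.
Local Notation HM := (vmodule_axioms M).
Local Notation D := (act om 0 : M -> M).
Local Notation L0 := (act om 1 : M -> M).
Implicit Types x y s t : M.

Lemma pr_act_cases k m n v x : weight_space k v ->
  p n (act v m x) = 0 \/
  exists n' : nat, n%:Z = n'%:Z + k - m - 1 /\ p n (act v m x) = act v m (p n' x).
Proof.
move=> kv; have [d0|d0] := leP 0 (n%:Z - k + m + 1).
  right; exists (absz (n%:Z - k + m + 1)%R).
  have e : n%:Z = (absz (n%:Z - k + m + 1)%R)%:Z + k - m - 1 by lia.
  by split => //; apply: (pr_act gM _ kv e).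
left; have [N hN] := pr_sum gM x;
  rewrite (hN N) // (act_sum HM) (lin_sum (pr_linear gM n)).
rewrite big1 // => i _; rewrite (pr_act_homogeneous gM _ _ kv (pr_in gM i x)) ifF //.
by apply/eqP; lia.
Qed.

(** Reduces a degree-dependent property of a generated submodule to its generators. *)
Lemma componentwise_submodule (P : nat -> set M) :
  (forall n, is_subspace (P n)) ->
  (forall k m (n n' : nat) v x, weight_space k v -> n'%:Z = n%:Z + k - m - 1 ->
     P n x -> P n' (act v m x)) ->
  is_submodule [set x | forall n, P n (p n x)].
Proof.
move=> Ps Pa; split.
  split=> [n|c x y hx hy n]; first by rewrite (lin0 (pr_linear gM n));
    apply: subspace0 (Ps n).
  by rewrite (pr_linear gM); apply: (Ps n).2.
move=> v m x hx n; have [N [f [fw ->]]] := homogeneous_sum cft v.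
rewrite (actl_sum HM) (lin_sum (pr_linear gM n)); apply: (subspace_sum_ord (Ps n)) => i.
have [->|[n' [e ->]]] := pr_act_cases m n x (fw i); first exact: subspace0 (Ps n).
exact: Pa (fw i) e (hx n').
Qed.

Lemma generated_graded (X : set M) :
  (forall x, X x -> exists n, A n x) -> graded_sub p (generated X).
Proof.
move=> Xh; have gX := generated_submodule X; split => // m x gx; move: m.
apply: (gx [set x | forall n, generated X (p n x)]).
  apply: (@componentwise_submodule (fun=> generated X)) => [_|k m n n' v y _ _];
    first exact: gX.1.
  exact: gX.2.
move=> y Xy n; have [n' Ay] := Xh y Xy; rewrite (pr_id gM n Ay).
by case: eqP => _; [apply: generated_mem|apply: subspace0 gX.1].
Qed.

(* Vacuum-like vectors of degree [e] generate eigenvectors of L(0) of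
   eigenvalue [n - e] in degree [n]. *)
Fixpoint L0_prod (d : nat) (n : int) (x : M) : M :=
  if d is d'.+1 then L0 (L0_prod d' n x) - (n - d'%:Z)%:~R *: L0_prod d' n x else x.

Lemma L0_prod_linear d n : linear (L0_prod d n).
Proof.
elim: d => [|d IH] c x y //=; rewrite IH (act_linr HM) !scalerDr scalerN opprD.
by rewrite !scalerA [c * _]mulrC addrACA.
Qed.

(** A mode shifts L(0)-eigenvalues and degrees by the same amount k - m - 1, so it passes through a
    product whose factors follow the degree. *)
Lemma L0_prod_act d n k m v x : weight_space k v ->
  L0_prod d (n + k - m - 1) (act v m x) = act v m (L0_prod d n x).
Proof.
move=> kv; elim: d => [|d IH] //=; rewrite IH (L0_comm _ _ kv) (actB HM) (actZ HM).
rewrite -addrA; congr (_ + _); rewrite -scalerBl -scaleNr -rmorphB -rmorphN.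
by congr (_%:~R *: _); lia.
Qed.

Lemma L0_prodC d n x : L0 (L0_prod d n x) = L0_prod d n (L0 x).
Proof.
rewrite -(L0_prod_act d n 1 x (@weight_conformal R V)).
by congr (L0_prod _ _ _); lia.
Qed.

Lemma L0_prod_homogeneous d n (m : nat) x : A m x -> A m (L0_prod d n x).
Proof.
move=> Ax; elim: d => //= d IH; apply: (subspaceB (grading_subspace gM m));
  last exact: subspaceZ (grading_subspace gM m) _ _ IH.
by apply: (act_homogeneous gM (@weight_conformal R V) IH); lia.
Qed.

Lemma L0_prod_eigen d n (c : int) x : L0 x = c%:~R *: x ->
  L0_prod d n x = (\prod_(e < d) (c - n + e%:Z))%:~R *: x.
Proof.
move=> Lx; elim: d => [|d IH] /=; first by rewrite big_ord0 scale1r.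
rewrite IH big_ord_recr /= (actZ HM) Lx !scalerA -scalerBl; congr (_ *: _).
by rewrite -!rmorphM -rmorphB; congr (_%:~R); ring.
Qed.

Definition vacuum_below (d : nat) : set M :=
  [set x | exists e, [/\ (e < d)%N, A e x & D x = 0]].

Lemma vacuum_below_graded d : graded_sub p (generated (vacuum_below d)).
Proof. by apply: generated_graded => x [e [_ Ax _]]; exists e. Qed.

(** On a generator of degree [e] below [d], L(0) is zero and the factor of index [e] vanishes;
    [L0_prod_act] carries this to everything generated. *)
Lemma L0_prod_vacuum_below d (n : nat) x :
  generated (vacuum_below d) x -> A n x -> L0_prod d n%:Z x = 0.
Proof.
move=> gx Ax; rewrite -(pr_same gM Ax); move: (n).
apply: (gx [set x | forall n, L0_prod d n%:Z (p n x) = 0]).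
  apply: (@componentwise_submodule (fun n => [set x | L0_prod d n%:Z x = 0])).
    move=> m; split; first exact: lin0 (L0_prod_linear d m).
    by move=> c y z /= hy hz; rewrite L0_prod_linear hy hz scaler0 addr0.
  by move=> k m i i' v y kv e /= hy; rewrite e L0_prod_act // hy (act0 HM).
move=> y [e [ed Ay Dy]] m; rewrite (pr_id gM m Ay).
case: eqP => [->|_]; last exact: lin0 (L0_prod_linear d m).
have L0y : L0 y = 0%:~R *: y by rewrite scale0r; apply: (@vacuum_like _ _ M om y 1 Dy).
rewrite (L0_prod_eigen _ _ L0y) (_ : \prod_(i < d) _ = 0) ?scale0r //.
by rewrite (bigD1 (Ordinal ed)) //= sub0r addNr mul0r.
Qed.

Hypotheses (uni : unitary V) (hol : holomorphic V).

Lemma shifted_grading (Q : vmodule V) B q (d : nat) : @graded_module R V Q B q ->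
  (forall e (x : Q), (e < d)%N -> B e x -> x = 0) ->
  @graded_module R V Q (fun n => B (n + d)%N) (fun n => q (n + d)%N).
Proof.
move=> gQ B0; split; first split.
- by move=> n; apply: grading_subspace gQ _.
- by move=> n; apply: pr_linear gQ _.
- by move=> n x; apply: pr_in gQ _ _.
- by move=> m n x Bx; rewrite (pr_id gQ _ Bx) eqn_add2r.
- move=> y; have [N hN] := pr_sum gQ y; exists N => B1 NB.
  rewrite {1}(hN (B1 + d)%N); last by lia.
  rewrite -(big_mkord xpredT (fun n => q n y)) (big_cat_nat (n := d)) //=; last by lia.
  rewrite big_nat big1 ?add0r => [|i /andP[_ id]]; last exact: B0 id (pr_in gQ i y).
  by rewrite -{1}[d]add0n big_addn addnK big_mkord.
move=> k m n v y kv Bx.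
have [d0|d0] := leP 0 (n%:Z + k - m - 1).
  have -> : n%:Z + k - m - 1 = (absz (n%:Z + k - m - 1)%R)%:Z by lia.
  by apply: (act_homogeneous gQ kv Bx); lia.
(* A target degree that is negative after the shift was below [d] before it, or already negative;
   both give zero. *)
have -> : act v m y = 0.
  have [d1|d1] := leP 0 ((n + d)%N%:Z + k - m - 1);
    last exact: (act_negative gQ kv Bx d1).
  apply: (B0 (absz ((n + d)%N%:Z + k - m - 1)%R)); first by lia.
  by apply: (act_homogeneous gQ kv Bx); lia.
by case: (_ - 1) d0.
Qed.

(** Modulo the submodule [S] generated below degree [d], [x] has lowest degree and so is
    vacuum-like. Applying the product of the L(0) - (d - j) over j < d corrects a nonzero multiple
    of [x] to a vector [x'] that is vacuum-like in [M] itself. *)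
Lemma generated_vacuum_step d x : (forall e y, (e < d)%N -> A e y ->
    generated (vacuum_below d) y) ->
  A d x -> generated (vacuum_below d.+1) x.
Proof.
move=> IH Ax; set S := generated (vacuum_below d).
have gS : graded_sub p S := vacuum_below_graded d.
have Ss : is_subspace S := gS.1.1.
have [Q [B [q [f [gQ [fl fa] fq fs fk]]]]] := graded_quotient gM gS.
have fin n y : A n y -> B n (f y) by move=> An; rewrite -(pr_same gM An) fq;
  apply: pr_in gQ _ _.
have B0 e z : (e < d)%N -> B e z -> z = 0.
  move=> ed Bz; have [y fy] := fs z.
  rewrite -(pr_same gQ Bz) -fy -fq; apply/fk.
  exact: IH ed (pr_in gM e y).
have gQ' := shifted_grading gQ B0.
have Bx : B (0 + d)%N (f x) by apply: fin.
have Dfx : act om 0 (f x) = 0.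
  apply: (degree0_vacuum_like cft uni hol gQ' Bx) => u u1.
  exact: (degree0_weight1 cft uni hol gQ' Bx u1).
have SD : S (D x) by apply/fk; rewrite fa.
have SL : S (L0 x) by apply/fk; rewrite fa; apply: (@vacuum_like _ _ Q om _ 1 Dfx).
have AL : A d (L0 x) by apply: (act_homogeneous gM (@weight_conformal R V) Ax); lia.
pose x' := L0_prod d d%:Z x.
have Ax' : A d x' by apply: L0_prod_homogeneous.
(* L(0) x lies in the degree [d] part of [S], which the product kills. *)
have L0x' : L0 x' = 0 by rewrite L0_prodC; apply: L0_prod_vacuum_below.
(* Since L(0) x lies in [S], each factor acts on [x] modulo [S] as the scalar -(d - j), so [c] comes
   out as (-1)^d d!. *)
have [c c0 Sc] : exists2 c : C, c != 0 & S (x' - c *: x).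
  have : (d <= d)%N by []; rewrite /x'; move: {1 3}d => j; elim: j => [|j IHj] jd.
    by exists 1; rewrite ?oner_eq0 // scale1r subrr; apply: subspace0 Ss.
  have [c c0 Sc] := IHj (ltnW jd).
  exists (- (d%:Z - j%:Z)%:~R * c).
    by rewrite mulf_neq0 // oppr_eq0 intr_eq0; apply/eqP; lia.
  have -> : L0_prod j.+1 d%:Z x - (- (d%:Z - j%:Z)%:~R * c) *: x
    = (L0 (L0_prod j d%:Z x - c *: x) + c *: L0 x)
      - (d%:Z - j%:Z)%:~R *: (L0_prod j d%:Z x - c *: x).
    rewrite /= (actB HM) (actZ HM) subrK scalerBr -scalerA scaleNr opprK opprB.
    by rewrite -addrA; congr (_ + _); rewrite addrC.
  apply: (subspaceB Ss); last exact: subspaceZ Ss _ _ Sc.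
  by apply: (subspaceD Ss); [apply: gS.1.2|apply: subspaceZ Ss _ _ SL].
have St : S (D x').
  have -> : D x' = D (x' - c *: x) + c *: D x by rewrite (actB HM) (actZ HM) subrK.
  by apply: (subspaceD Ss); [apply: gS.1.2|apply: subspaceZ Ss _ _ SD].
have At : A d.+1 (D x').
  by apply: (act_homogeneous gM (@weight_conformal R V) Ax'); lia.
have L0t : L0 (D x') = 1%:~R *: D x'.
  by rewrite L0_translation L0x' (act0 HM) add0r scale1r.
(* The product for degree d + 1 kills [D x'], which lies in [S]. But L(0) is 1 on [D x'], so the
   factors are the scalars i - d with i < d, none of them zero. *)
have Dx' : D x' = 0.
  have := L0_prod_vacuum_below St At; rewrite (L0_prod_eigen _ _ L0t).
  move/eqP; rewrite scaler_eq0 intr_eq0 => /orP[/prodf_eq0[[i /= id] _ /eqP]|/eqP//].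
  by lia.
have S'x' : generated (vacuum_below d.+1) x'.
  by apply: generated_mem; exists d; split => //; apply: leqnn.
have S's : is_subspace (generated (vacuum_below d.+1)) := (generated_submodule _).1.
apply: (subspaceZ_inv S's c0); rewrite -[c *: x](subKr x'); apply: (subspaceB S's S'x').
apply: generatedS Sc => y [e [ed Ae De]]; exists e; split => //; lia.
Qed.

Lemma generated_vacuum_like x : generated [set y | D y = 0] x.
Proof.
have h d y : A d y -> generated (vacuum_below d.+1) y.
  elim/ltn_ind: d y => d IH y; apply: generated_vacuum_step => e z ed Az.
  apply: generatedS (IH e ed z Az) => t [e' [ee At Dt]]; exists e'; split => //; lia.
have Ws := (generated_submodule [set y | D y = 0]).1.
have [N hN] := pr_sum gM x; rewrite (hN N) //; apply: (subspace_sum_ord Ws) => i.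
by apply: generatedS (h i _ (pr_in gM i x)) => y [e []].
Qed.

End Graded.
End Generation.

(** * Decomposition into copies of V *)

Section DirectSum.
Variables (R : realType) (V : voa R) (M : vmodule V).
Hypothesis Vsimple : simple_voa V.
Local Notation C := R[i].
Local Notation HV := (voa_jacobi V).
Local Notation HM := (vmodule_axioms M).
Local Notation one := (vacuum V).
Local Notation om := (conformal V).
Implicit Types (u v w : V) (x y z : M) (s t : seq M).

(** The [u] with u_(-1) y in [W] form a submodule of [V]. It contains the nonzero [v], hence by
    simplicity also the vacuum. *)
Lemma simple_preimage y (W : set M) v : act om 0 y = 0 -> is_submodule W ->
  v != 0 -> W (act v (- 1) y) -> W y.
Proof.
move=> Dy [Ws Wa] v0 Wv; have [_ /(_ [set u | W (act u (- 1) y)])] := Vsimple.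
have Lsub : is_submodule (M := adjoint_module V) [set u | W (act u (- 1) y)].
  split; last by move=> u n w /= Ww; rewrite (vacuum_like_jacobi _ _ _ Dy); apply: Wa.
  split; first by rewrite /= (actl0 HM); apply: subspace0 Ws.
  by move=> c u w /= Wu Ww; rewrite (act_linl HM); apply: Ws.2.
move=> /(_ Lsub)[e|e].
  have : [set u | W (act u (- 1) y)] v by [].
  by rewrite e /= => /eqP; rewrite (negPf v0).
have : [set u | W (act u (- 1) y)] one by rewrite e.
by rewrite /= (act_one HM) eqxx.
Qed.

Lemma vacuum_like_inj y : act om 0 y = 0 -> y != 0 -> injective (fun v =>
  act v (- 1) y).
Proof.
move=> Dy y0 u v /= /eqP; rewrite -subr_eq0 -(actlB HM) => /eqP e.
apply/eqP; rewrite -subr_eq0; apply/negPn/negP => uv0; move/eqP: y0; apply.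
apply: (@simple_preimage y [set 0] (u - v)) => //.
split; last by move=> w n x /= ->; rewrite (act0 HM).
by split=> //= c x z -> ->; rewrite scaler0 addr0.
Qed.

Definition copies_sum s (f : M -> V) : M := \sum_(x <- s) act (f x) (- 1) x.

(** Linear independence with coefficients from [V] acting through the mode -1; it says that the
    copies of [V] generated by the elements of [B] form a direct sum. *)
Definition independent (B : set M) : Prop :=
  (forall x, B x -> act om 0 x = 0 /\ x != 0) /\
  forall s (f : M -> V), uniq s -> (forall x, x \in s -> B x) ->
    copies_sum s f = 0 -> forall x, x \in s -> f x = 0.

Definition span_of (B : set M) : set M :=
  [set y | exists s (f : M -> V),
    [/\ uniq s, forall x, x \in s -> B x & y = copies_sum s f]].

Lemma copies_sum_widen s t (f : M -> V) : uniq s -> uniq t -> {subset s <= t} ->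
  copies_sum s f = copies_sum t (fun x => if x \in s then f x else 0).
Proof.
move=> us ut st; rewrite /copies_sum.
rewrite [RHS](eq_bigr (fun x => if x \in s then act (f x) (- 1) x else 0)); last first.
  by move=> x _; case: ifP => // _; rewrite (actl0 HM).
rewrite -big_mkcond -big_filter; apply: perm_big; apply: uniq_perm => //.
  exact: filter_uniq.
by move=> x; rewrite mem_filter; case xs: (x \in s) => //=; rewrite st.
Qed.

Lemma span_of_submodule (B : set M) : independent B -> is_submodule (span_of B).
Proof.
move=> [Bv _]; split.
  split; first by exists [::], (fun=> 0); split => //; rewrite /copies_sum big_nil.
  move=> c x y [s [f [us sB ->]]] [t [g [ut tB ->]]].
  pose r := undup (s ++ t); have ur : uniq r := undup_uniq _.
  have sr : {subset s <= r} by move=> z zs; rewrite mem_undup mem_cat zs.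
  have tr : {subset t <= r} by move=> z zt; rewrite mem_undup mem_cat zt orbT.
  rewrite (copies_sum_widen f us ur sr) (copies_sum_widen g ut ur tr).
  exists r, (fun z => c *: (if z \in s then f z else 0) + (if z \in t then g z else 0)).
  split => //; first by move=> z; rewrite mem_undup mem_cat => /orP[/sB|/tB].
  rewrite /copies_sum scaler_sumr -big_split; apply: eq_bigr => z _ /=.
  by rewrite (act_linl HM).
move=> v n x [s [f [us sB ->]]]; exists s, (fun z => mode v n (f z)); split => //.
rewrite /copies_sum (act_sum HM); apply: eq_big_seq => z /sB/Bv[Dz _].
by rewrite (vacuum_like_jacobi _ _ _ Dz).
Qed.

(** The argument for bases of vector spaces, with [simple_preimage] in place of division by a
    nonzero coefficient. *)
Lemma maximal_independent : exists B : set M, independent B /\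
  forall y, act om 0 y = 0 -> span_of B y.
Proof.
have [F FP Ftot|B [Bi Bmax]] := @Zorn_bigcup M independent.
  split; first by move=> x [B /FP[Bv _] /Bv].
  move=> s f us sF sf0 x xs.
  (* Finitely many vectors in the union of a chain lie in one member; [x] ensures that the chain has
     a member at all. *)
  have [B [FB sB]] : exists B, F B /\ forall y, y \in s -> B y.
    have [B0 FB0 _] := sF x xs.
    elim: s {us sf0 xs} sF => [|y s IH] sF; first by exists B0.
    have [B1 [FB1 h1]] := IH (fun z zs => sF z (@mem_behead _ (y :: s) z zs)).
    have [B2 FB2 h2] := sF y (mem_head y s).
    have [BB|BB] := Ftot _ _ FB1 FB2.
      by exists B2; split => // z; rewrite inE => /predU1P[->//|/h1/BB].
    by exists B1; split => // z; rewrite inE => /predU1P[->|/h1//]; apply: BB.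
  by have [_ Bi] := FP B FB; apply: (Bi s f).
exists B; split => // y Dy; apply: contrapT => nspan.
have Ws := span_of_submodule Bi.
have y0 : y != 0 by apply/eqP => e; apply: nspan; rewrite e; apply: subspace0 Ws.1.
have By : ~ B y.
  move=> By; apply: nspan; exists [:: y], (fun=> one); split => //.
    by move=> z; rewrite inE => /eqP->.
  by rewrite /copies_sum big_seq1 (act_one HM) eqxx.
apply: (Bmax (B `|` [set y])).
  by split; [move=> z Bz; left|move=> h; apply: By; apply: h; right].
split; first by move=> z [/Bi.1|->].
move=> s f us sB sf0.
have sB' z : z \in s -> z != y -> B z by move=> /sB[//|-> /eqP].
have [ys|ys] := boolP (y \in s); last first.
  by apply: Bi.2 => // z zs; apply: sB' => //; apply: contraNneq ys => <-.
have us' : uniq (rem y s) by apply: rem_uniq.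
have remB z : z \in rem y s -> B z.
  by rewrite mem_rem_uniq // inE => /andP[zy zs]; apply: sB'.
have split0 : act (f y) (- 1) y + copies_sum (rem y s) f = 0.
  by rewrite -sf0 /copies_sum (big_rem y ys).
have fy : f y = 0.
  apply/eqP/negPn/negP => fy; apply: nspan; apply: (simple_preimage Dy Ws fy).
  have -> : act (f y) (- 1) y = - copies_sum (rem y s) f by apply/eqP;
    rewrite -addr_eq0 split0.
  by apply: (subspaceN Ws.1); exists (rem y s), f.
rewrite fy (actl0 HM) add0r in split0.
move=> z zs; have [->//|zy] := eqVneq z y.
by apply: (Bi.2 _ f us' remB split0); rewrite mem_rem_uniq // inE zy.
Qed.

Lemma direct_sum_of_vacuum_like : 
  (forall x, generated [set y : M | act om 0 y = 0] x) ->
  direct_sum_of_copies (adjoint_module V) M.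
Proof.
move=> gen; have [B [Bi Bspan]] := maximal_independent.
have Ws := span_of_submodule Bi.
pose I : choiceType := {x : M | `[< B x >]}.
have IB (i : I) : B (val i) by apply/asboolP/(valP i).
pose g (i : I) (v : V) : M := act v (- 1) (val i).
exists I, g; split.
  move=> i; have [Di i0] := Bi.1 _ (IB i).
  by split; [exact: vacuum_like_hom|exact: vacuum_like_inj].
have sum_val (r : seq I) (f : I -> V) : uniq r ->
    exists h : M -> V, (forall i, i \in r -> h (val i) = f i)
    /\ \sum_(i <- r) g i (f i) = copies_sum (map val r) h.
  (* [copies_sum] takes coefficients defined on all of [M], so those indexed by [I] are extended by
     zero. *)
  move=> ur; pose h x := if insub x is Some i then f i else 0.
  have hf (i : I) : h (val i) = f i by rewrite /h valK.
  exists h; split => //; rewrite /copies_sum big_map; apply: eq_bigr => i _.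
  by rewrite hf.
have indep (r : seq I) (f : I -> V) : uniq r -> \sum_(i <- r) g i (f i) = 0 ->
    forall i, i \in r -> f i = 0.
  move=> ur; have [h [hf ->]] := sum_val r f ur; move=> r0 i ir.
  rewrite -hf //; apply: (Bi.2 _ h _ _ r0); last exact: map_f.
    by rewrite map_inj_uniq //; apply: val_inj.
  by move=> _ /mapP[j _ ->].
have glin i : linear (g i) by exact: (act_linl HM).
split.
  move=> i; split; first by exists 0 => //; apply: lin0 (glin i).
  by move=> c _ _ [u _ <-] [v _ <-]; exists (c *: u + v) => //; apply: glin.
move=> x.
have [s [f [us sB xs]]] : span_of B x.
  by apply: (gen x) => // y Dy; apply: Bspan.
pose r : seq I := pmap insub s.
have rs : map val r = s.
  by rewrite pmap_filter; [apply/all_filterP/allP => z /sB Bz; rewrite isSome_insub;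
    apply/asboolP|exact: insubK].
have ur : uniq r by rewrite -(map_inj_uniq val_inj) rs.
pose F (i : I) := if i \in r then g i (f (val i)) else 0.
have FS i : i \notin r -> F i = 0 by rewrite /F => /negPf->.
have fsumr (G : I -> M) (t : seq I) : uniq t -> (forall i, i \notin t -> G i = 0) ->
    \sum_(i \in [set: I]) G i = \sum_(i <- t) G i.
  move=> ut G0; rewrite -(@fsbig_widen _ _ _ _ [set` t]) //.
    by rewrite -fsbig_seq.
  by move=> i [_ /= /negP it]; apply: G0.
exists F; split.
  split.
  - by move=> i; rewrite /F; case: ifP => _; [exists (f (val i))|exists 0 => //;
    apply: lin0 (glin i)].
  - apply: (@sub_finite_set _ _ [set` r]); last exact: finite_seq.
    by move=> i /=; apply: contraR => /FS ->.
  - rewrite (fsumr F r ur FS) xs -rs /copies_sum big_map; apply: eq_big_seq => i ir.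
    by rewrite /F ir.
move=> G [Gin /finite_seqP[t tG] xG].
have /choice[a Ga] : forall i, exists v, G i = g i v.
  by move=> i; have [v _ gv] := Gin i; exists v.
pose q := undup (r ++ t); have uq : uniq q := undup_uniq _.
have Fq i : i \notin q -> F i = 0.
  by rewrite mem_undup mem_cat negb_or => /andP[/FS].
have Gq i : i \notin q -> G i = 0.
  rewrite mem_undup mem_cat negb_or => /andP[_ it].
  by apply: contrapT => /eqP Gi; have : [set i | G i != 0] i by [];
    rewrite tG /= (negPf it).
(* Uniqueness: these are the coefficients of the difference of the two decompositions, and
   independence over the joint support [q] makes them vanish. *)
pose b i : V := (if i \in r then f (val i) else 0) - a i.
have gb i : g i (b i) = F i - G i.
  rewrite /b (linB (glin i)) -Ga; congr (_ - _); rewrite /F.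
  by case: ifP => // _; apply: lin0 (glin i).
have sum0 : \sum_(i <- q) g i (b i) = 0.
  under eq_bigr => i _ do rewrite gb.
  rewrite sumrB -(fsumr F q uq Fq) -(fsumr G q uq Gq) -xG (fsumr F r ur FS).
  rewrite xs -rs /copies_sum big_map; apply/eqP; rewrite subr_eq0; apply/eqP.
  by apply: eq_big_seq => i ir; rewrite /F ir.
apply/funext => i; have [iq|iq] := boolP (i \in q); last by rewrite Fq // Gq.
apply/eqP; rewrite -subr_eq0 -gb (indep q b uq sum0 i iq).
by rewrite (lin0 (glin i)).
Qed.

End DirectSum.

Theorem theorem1 (R : realType) (V : voa R) :
  unitary V -> simple_voa V -> holomorphic V -> cft_type V ->
  forall M : vmodule V,
    N_gradable M -> direct_sum_of_copies (adjoint_module V) M.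
Proof.
move=> uni simple hol cft M /N_gradableP[A [p gM]].
apply: (direct_sum_of_vacuum_like simple) => x.
exact: (generated_vacuum_like cft gM uni hol).
Qed.
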